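(* For every ordinal $\xi$, every operator $A:X\to Y$ with $Sz(A)\leqslant\omega^\xi$, and every $1<p<\infty$, there exists a Banach space $Z$ with $\mathbf{p}_\xi(Z)\leqslant p$ such that $A$ factors through $Z$ (i.e. $A=RS$ for some bounded operators $S:X\to Z$, $R:Z\to Y$).
   Context: Operators are bounded linear maps between Banach spaces. For $K\subset X^*$ $w^*$-compact and $\varepsilon>0$, $s_\varepsilon(K)$ is the set of $x^*\in K$ such that $\operatorname{diam}(V\cap K)>\varepsilon$ for every $w^*$-neighborhood $V$ of $x^*$; $s^0_\varepsilon(K)=K$, $s^{\zeta+1}_\varepsilon(K)=s_\varepsilon(s^\zeta_\varepsilon(K))$, $s_\varepsilon^\zeta(K)=\bigcap_{\eta<\zeta}s^\eta_\varepsilon(K)$ for limit $\zeta$. $Sz(K,\varepsilon)$ is the least $\zeta$ with $s_\varepsilon^\zeta(K)=\varnothing$ ($\infty$ if none), $Sz(K)=\sup_{\varepsilon>0}Sz(K,\varepsilon)$. $Sz_\xi(K,\varepsilon)$ is the least $\beta$ with $s_\varepsilon^{\omega^\xi\beta}(K)=\varnothing$. If $Sz(K)\leqslant\omega^{\xi+1}$, $\mathbf{p}_\xi(K)=\limsup_{\varepsilon\to0^+}\frac{\log Sz_\xi(K,\varepsilon)}{|\log\varepsilon|}$; otherwise $\mathbf{p}_\xi(K)=\infty$. For $A:X\to Y$, $Sz(A)=Sz(A^*B_{Y^*})$; for a Banach space $Z$, $\mathbf{p}_\xi(Z)=\mathbf{p}_\xi(B_{Z^*})$. *)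

(* Defs.v *)
From HB Require Import structures.
From mathcomp Require Import all_boot all_order all_algebra.
From mathcomp Require Import complex.
From mathcomp Require Import all_classical all_reals all_analysis.

Set Implicit Arguments.
Unset Strict Implicit.
Unset Printing Implicit Defensive.

Import Order.TTheory GRing.Theory Num.Theory.
Import numFieldNormedType.Exports.

Local Open Scope classical_set_scope.
Local Open Scope ring_scope.
Local Open Scope ereal_scope.

(* Ordinals are represented by well-founded trees; [Olim i f] denotes the
   supremum of the nonempty family [f] (which need not be strictly increasing,
   so that suprema that are attained are allowed as well).  Distinct trees may
   denote the same ordinal: only the preorder [ole] is meaningful. *)
Inductive ord : Type :=
| Ozero : ord
| Osucc of ord
| Olim (J : Type) of inhabited J & (J -> ord).

(* [Osucc a <= b] holds iff [a < b], and [a < b] is read off the shape of [b]: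
   [a < Osucc b'] iff [a <= b'], and [a < sup f] iff [a < f i] for some [i]. *)
Fixpoint olt_of (below : ord -> Prop) (b : ord) : Prop :=
  match b with
  | Ozero => False
  | Osucc b' => below b'
  | Olim J _ f => exists i : J, olt_of below (f i)
  end.

Fixpoint ole (a : ord) : ord -> Prop :=
  match a with
  | Ozero => fun=> True
  | Osucc a' => olt_of (ole a')
  | Olim J _ f => fun b => forall i : J, ole (f i) b
  end.

Fixpoint oadd (a b : ord) : ord :=
  match b with
  | Ozero => a
  | Osucc b' => Osucc (oadd a b')
  | Olim J h f => Olim h (fun i => oadd a (f i))
  end.

Fixpoint omul (a b : ord) : ord :=
  match b with
  | Ozero => Ozero
  | Osucc b' => oadd (omul a b') a
  | Olim J h f => Olim h (fun i => omul a (f i))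
  end.

Definition onat (n : nat) : ord := iter n Osucc Ozero.

Definition omega : ord := Olim (inhabits 0%N) onat.

Fixpoint omega_pow (b : ord) : ord :=
  match b with
  | Ozero => Osucc Ozero
  | Osucc b' => omul (omega_pow b') omega
  | Olim J h f => Olim h (fun i => omega_pow (f i))
  end.

(* Ordinals extended by [None], which stands for the symbol infinity. *)
Definition xord := option ord.

Definition xole (a : xord) (b : ord) : Prop :=
  if a is Some a' then ole a' b else False.

(* The preorder [ole] is total and well-founded, so the value is [None] exactly
   when no ordinal satisfies [P]. *)
Definition oleast (P : ord -> Prop) : xord :=
  if pselect (exists b, P b /\ forall c, P c -> ole b c) is left h
  then Some (projT1 (cid h)) else None.

Definition xosup (J : Type) (h : inhabited J) (F : J -> xord) : xord :=
  if `[< forall i, F i >] then Some (Olim h (fun i => odflt Ozero (F i)))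
  else None.

(* An infinite ordinal has infinitely many finite ordinals below it and is
   therefore sent to [+oo]; a finite ordinal is sent to its value. *)
Definition xord_ereal (R : realType) (a : xord) : \bar R :=
  if a is Some a' then ereal_sup [set n%:R%:E | n in [set n | ole (onat n) a']]
  else +oo.

Variant scalars (R : realType) := RealScalars | ComplexScalars.

Definition scalar_field (R : realType) (s : scalars R) : numFieldType :=
  match s with
  | RealScalars => R
  | ComplexScalars => R[i]%C
  end.

(* In MathComp-Analysis the norm of a normed module takes its values in the
   scalar field; [rnorm] is the same norm with values in [R]. *)
Definition scalar_Re (R : realType) (s : scalars R) : scalar_field s -> R :=
  match s with
  | RealScalars => id
  | ComplexScalars => @complex.Re R
  end.

Section Szlenk.
Context {R : realType} {s : scalars R}.
Notation K := (scalar_field s).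

Definition rnorm {V : normedModType K} (x : V) : R := scalar_Re `|x|%R.

Definition bounded_map {V W : normedModType K} (f : V -> W) : Prop :=
  exists M : R, forall x, (rnorm (f x) <= M * rnorm x)%R.

(* The dual of [X] is a subset of the space of all functions from [X] to the
   scalars with the topology of pointwise convergence, whose trace on the dual
   is the w*-topology. *)
Definition functionals (X : normedModType K) := {ptws X -> K^o}.

Definition dual (X : normedModType K) : set (functionals X) :=
  [set f | linear (f : X -> K^o) /\ bounded_map (f : X -> K^o)].
Global Arguments dual X _ : clear implicits.

Definition dual_norm (X : normedModType K) (f : X -> K^o) : \bar R :=
  ereal_sup [set (rnorm (f x))%:E | x in [set x : X | (rnorm x <= 1)%R]].

Definition dual_ball (X : normedModType K) : set (functionals X) :=
  [set f | dual X f /\ dual_norm f <= 1].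
Global Arguments dual_ball X _ : clear implicits.

Section Sets.
Context {X : normedModType K}.
Implicit Types (B : set (functionals X)) (e : R).

(* The supremum over the empty set is [-oo] instead of [0], which makes no
   difference to [szlenk_deriv]: there [V `&` B] always contains [f]. *)
Definition diam B : \bar R :=
  ereal_sup [set dual_norm ((fg.1 : X -> K^o) \- (fg.2 : X -> K^o))%R |
             fg in B `*` B].

Definition szlenk_deriv e B : set (functionals X) :=
  [set f | B f /\ forall V, nbhs f V -> e%:E < diam (V `&` B)].

(* The iterates decrease with [a] for [ole]; hence at [Olim h f] the
   intersection is the one over all ordinals below the supremum if the latter is
   not attained, and the iterate at the largest [f i] if it is. *)
Fixpoint szlenk_iter e (a : ord) B : set (functionals X) :=
  match a with
  | Ozero => B
  | Osucc a' => szlenk_deriv e (szlenk_iter e a' B)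
  | Olim J _ f => \bigcap_(i in [set: J]) szlenk_iter e (f i) B
  end.

Definition Sz_eps B e : xord := oleast (fun a => szlenk_iter e a B = set0).

Definition Sz B : xord :=
  xosup (inhabits (1%:pos%R : {posnum R})) (fun e : {posnum R} => Sz_eps B e%:num).

Definition Sz_xi (xi : ord) B e : xord :=
  oleast (fun b => szlenk_iter e (omul (omega_pow xi) b) B = set0).

Definition szlenk_power (xi : ord) B : \bar R :=
  if `[< xole (Sz B) (omega_pow (Osucc xi)) >]
  then limf_esup
         (fun e : R => lne (xord_ereal R (Sz_xi xi B e)) / `|ln e|%:E) 0^'+
  else +oo.

End Sets.

Definition operator_Sz {X Y : normedModType K} (A : X -> Y) : xord :=
  Sz [set ((g : Y -> K^o) \o A : functionals X) | g in dual_ball Y].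

Definition space_szlenk_power (xi : ord) (Z : normedModType K) : \bar R :=
  szlenk_power xi (dual_ball Z).

End Szlenk.

(* Main.v *)
(* The factorization is through a c_0-version of the Davis-Figiel-Johnson-Pelczynski
   space.  With the K-functional
     g_n(y) = inf_x (2^n |y - A x| + 2^-n |x|),
   let Z be the space of all y in Y with g_n(y) -> 0, normed by sup_n g_n(y); then
   A maps X into Z.  By Hahn-Banach and w*-compactness every functional in the
   unit ball of Z^* is a series sum_n c_n y_n with sum_n |c_n| <= 1 and
   |y_n| <= g_n on Y.  On differences y of functionals dominated by g_n the norm
   of Z^* is small as soon as the norm of A^* y is small, so finitely many of the y_n
   can be derived together: omega^xi derivations empty a finite product of sets each
   of which is emptied by omega^xi derivations, because omega^xi is additively
   indecomposable.  Localizing at a point whose first weights almost exhaust the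
   mass sum_n |c_n|, one finds that omega^xi derivations lower the mass by a fixed
   multiple of epsilon.  Hence Sz_xi(Z, epsilon) <= C / epsilon, which gives
   p_xi(Z) <= 1, whatever p is. *)
From HB Require Import structures.
Require Import Defs.
From mathcomp Require Import all_boot all_order all_algebra.
From mathcomp Require Import complex.
From mathcomp Require Import all_classical all_reals all_analysis.
From mathcomp Require Import ring lra.

Set Implicit Arguments.
Unset Strict Implicit.
Unset Printing Implicit Defensive.

Import Order.TTheory GRing.Theory Num.Theory.
Import numFieldNormedType.Exports.

Local Open Scope classical_set_scope.
Local Open Scope ring_scope.

(** * Ordinals and derivations *)

(** An expansion [sum_n c_n y_n] of a functional on Z is not unique and need not vary
    w*-continuously with it, so the ball of Z^* is not derived directly. The work is done on a
    compact space of parameters (weights, functionals on Y, a functional on Z) that maps onto the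
    ball, and derivations are lifted along this map by compactness. This is why derivations are set
    up for an arbitrary relation [far] on a topological space: it can be pulled back along a map.
    The expansion enters as inequalities bounding, for each N, the remainder after N terms by the
    supremum of g_n over n >= N. Each of them is a closed condition on finitely many coordinates,
    and truncated expansions satisfy the first few, so full expansions arise as cluster points.
    Since g_n(z) -> 0 on Z, all of them together give convergence; this is what the c_0-condition is
    for. Origin of the constant: two nearby points whose heads carry all but eta of the mass differ
    by at most 5 eta (two tails eta each, weights 2 eta, functionals eta). Lifting doubles the
    separation, so at separation 10 eta each block of omega^xi derivations costs mass eta. *)

Lemma ole_lim_r a J (h : inhabited J) (f : J -> ord) i :
  ole a (f i) -> ole a (Olim h f).
Proof.
elim: a => [|a IH|J' h' g IH] //=; first by move=> H; exists i.
by move=> H j; exact: (IH j (H j)).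
Qed.

Lemma ole_refl a : ole a a.
Proof. by elim: a => // J h f IH /= i; exact: (@ole_lim_r _ J h f i). Qed.

Lemma ole_trans b a c : ole a b -> ole b c -> ole a c.
Proof.
elim: a b c => [|a IH|J h f IH] // b c; last first.
  by move=> H bc i; exact: (IH i b c (H i) bc).
rewrite /=; elim: b c => [|b IHb|J h f IHb] // c /=.
  move=> ab; elim: c => [|c _|J h f IHc] //=; first exact: IH.
  by move=> [i /IHc H]; exists i.
by move=> [i H] H2; exact: (IHb i c H (H2 i)).
Qed.

Lemma ole_olt_total a b : ole a b \/ ole (Osucc b) a.
Proof.
(* Comparability with [c] on one side is turned into comparability on the other side. Since
   [ole (Osucc b) (Osucc a)] unfolds to [ole b a], this is exactly the successor case of the outer
   induction. *)
have upper c : (forall d, ole c d \/ ole (Osucc d) c) ->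
    forall d, ole d c \/ ole (Osucc c) d.
  move=> Tc; elim=> [|d _|J h f IH]; first by left.
    by rewrite /=; case: (Tc d) => H; [right|left].
  case: (pselect (forall i, ole (f i) c)) => [H|/existsNP[i Hi]]; first by left.
  by right => /=; exists i; case: (IH i).
elim: a b => [|a IH|J h f IH] b; first by left.
  by have [H|H] := upper a IH b; [right|left].
case: (pselect (forall i, ole (f i) b)) => [H|/existsNP[i Hi]]; first by left.
by right => /=; exists i; case: (IH i b).
Qed.

Lemma ole_succ a : ole a (Osucc a).
Proof.
elim: a => //= J h f IH i; apply: ole_trans (IH i) _.
by rewrite /=; apply: ole_lim_r (ole_refl _).
Qed.

Lemma ole_total a b : ole a b \/ ole b a.
Proof.
have [|H] := ole_olt_total a b; [by left|right].
exact: ole_trans (ole_succ b) H.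
Qed.

Lemma olt_acc a : Acc (fun c d => ole (Osucc c) d) a.
Proof.
(* Generalized to everything below [a]: below a limit one only knows that a tree lies under some
   [f i], not that it is one of the [f i]. *)
suff : forall b, ole b a -> Acc (fun c d => ole (Osucc c) d) b.
  by apply; exact: ole_refl.
elim: a => [|a IH|J h f IH] b ba; constructor => c cb.
- by have := ole_trans cb ba.
- exact: IH (ole_trans cb ba).
- have [i ci] := ole_trans cb ba.
  by apply: (IH i); exact: ole_trans (ole_succ c) ci.
Qed.

Lemma ole_least (P : ord -> Prop) : (exists a, P a) ->
  exists b, P b /\ forall c, P c -> ole b c.
Proof.
case=> a; elim: (olt_acc a) => {}a _ IH Pa.
have [[c [Pc ca]]|H] := pselect (exists c, P c /\ ole (Osucc c) a).
  exact: IH ca Pc.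
exists a; split=> // c Pc; have [//|ca] := ole_olt_total a c.
by exfalso; apply: H; exists c.
Qed.

Lemma oleast_le (P : ord -> Prop) a : P a ->
  exists2 b, oleast P = Some b & P b /\ ole b a.
Proof.
move=> Pa; rewrite /oleast; case: pselect => [h|/(_ (ole_least (ex_intro _ a Pa)))//].
by case: (cid h) => b /= [Pb H]; exists b => //; split=> //; exact: H.
Qed.

Lemma oleast_some (P : ord -> Prop) a : oleast P = Some a -> P a.
Proof.
by rewrite /oleast; case: pselect => // h; case: (cid h) => b /= [Pb _] [<-].
Qed.

Lemma ole_onat m n : ole (onat m) (onat n) -> (m <= n)%N.
Proof. by elim: m n => [|m IH] [|n] //= /IH. Qed.

Section Derivation.
Context {T : topologicalType}.
Implicit Types (far : T -> T -> Prop) (B E O : set T) (a b : ord).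

(** The Szlenk derivation is the case where [far] says that the norm distance exceeds epsilon. On a
    space of parameters [far] is such a relation between the images of two points. *)
Definition deriv far B : set T :=
  [set x | B x /\ forall V, nbhs x V ->
     exists u v, [/\ V u, B u, V v, B v & far u v]].

Fixpoint deriv_iter far a B : set T :=
  match a with
  | Ozero => B
  | Osucc a' => deriv far (deriv_iter far a' B)
  | Olim J _ f => \bigcap_(i in [set: J]) deriv_iter far (f i) B
  end.

Lemma deriv_mono far B E : B `<=` E -> deriv far B `<=` deriv far E.
Proof.
move=> BE x [Bx H]; split; first exact: BE.
by move=> V /H[u [v [? ? ? ? ?]]]; exists u, v; split=> //; exact: BE.
Qed.

Lemma deriv_iter_mono far a B E : B `<=` E ->
  deriv_iter far a B `<=` deriv_iter far a E.
Proof.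
elim: a => [|a IH|J h f IH] //= BE; first exact: deriv_mono (IH BE).
by move=> x H i _; exact: (IH i BE x (H i I)).
Qed.

Lemma deriv_iter_sub far a B : deriv_iter far a B `<=` B.
Proof.
elim: a => [|a IH|J [j] f IH] //=; first by move=> x [/IH].
by move=> x H; exact: (IH j x (H j I)).
Qed.

Lemma deriv_iter_anti far a b B : ole a b ->
  deriv_iter far b B `<=` deriv_iter far a B.
Proof.
elim: a b => [|a IH|J h f IH] b /=.
- by move=> _; exact: deriv_iter_sub.
- elim: b => [|b _|J h f IHb] //=; first by move=> /IH; exact: deriv_mono.
  by move=> [i /IHb H] x Hx; apply: H; exact: Hx.
- by move=> H x bx i _; exact: (IH i b (H i) x bx).
Qed.

Lemma deriv_iter_add far a b B :
  deriv_iter far (oadd a b) B = deriv_iter far b (deriv_iter far a B).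
Proof.
elim: b => [|b IH|J h f IH] //=; first by rewrite IH.
by apply: eq_bigcapr => i _; exact: IH.
Qed.

(** Derivation is local, because the far pair near a point of [O] may be sought inside [O]. This
    allows passing to a neighborhood on which finitely many weights are nearly constant. *)
Lemma deriv_iter_localize far a B O : open O ->
  deriv_iter far a B `&` O `<=` deriv_iter far a (B `&` O).
Proof.
move=> oO; elim: a => [|a IH|J h f IH] //=.
  move=> x [[Bx H] Ox]; split; first exact: IH.
  move=> V Vx; have [|u [v [[Vu Ou] Bu [Vv Ov] Bv uv]]] := H (V `&` O).
    by apply: filterI => //; exact: open_nbhs_nbhs.
  by exists u, v; split=> //; exact: IH.
by move=> x [H Ox] i _; apply: (IH i); split=> //; exact: H.
Qed.

(** Iterates are closed relative to [E]: a neighborhood without far pairs of survivors loses all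
    points of its interior at the next step. Both the product argument and the lifting by
    compactness rest on this. *)
Lemma deriv_iter_relclosed far a E t : ~ deriv_iter far a E t -> E t ->
  exists V, open_nbhs t V /\ forall u, V u -> ~ deriv_iter far a E u.
Proof.
move=> + Et; elim: a => [|a IH|J h f IH] //=.
- move=> nt; have [at_|nat_] := pselect (deriv_iter far a E t); last first.
    by have [V [Vt H]] := IH nat_; exists V; split=> // u Vu [/(H _ Vu)].
  have [V [Vt H]] : exists V, nbhs t V /\ forall u v, V u -> deriv_iter far a E u ->
      V v -> deriv_iter far a E v -> ~ far u v.
    apply: contrapT => /forallNP nV; apply: nt; split=> // V Vt.
    apply: contrapT => nuv; apply: (nV V); split=> // u v Vu Eu Vv Ev uv.
    by apply: nuv; exists u, v.
  exists V°; split; first by split; [exact: open_interior|exact: Vt].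
  move=> u Vu [au /(_ V)[|v [w [Vv Ev Vw Ew vw]]]]; first exact: Vu.
  exact: (H v w).
- move=> /existsNP[i /not_implyP[_ nti]].
  have [V [Vt H]] := IH i nti; exists V; split=> // u Vu /(_ i I).
  exact: H.
Qed.

End Derivation.

(** * Derivations observed through finitely many coordinates *)

Section BoxLemma.
Context {P T : topologicalType}.
Variables (N : nat) (pi_ : nat -> P -> T).
Variables (farP : P -> P -> Prop) (far : T -> T -> Prop).
Hypothesis N0 : (0 < N)%N.
Hypothesis pi_cont : forall n x V, (n < N)%N -> nbhs (pi_ n x) V ->
  nbhs x (pi_ n @^-1` V).

Let nbhs_box (x : P) (Q : nat -> set T) :
  (forall n, (n < N)%N -> exists V, nbhs (pi_ n x) V /\ V `<=` Q n) ->
  exists O, open_nbhs x O /\ forall u n, O u -> (n < N)%N -> Q n (pi_ n u).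
Proof.
move=> H.
have HN : nbhs x [set u | forall n, (n < N)%N -> Q n (pi_ n u)].
  have HM M : (M <= N)%N -> nbhs x [set u | forall n, (n < M)%N -> Q n (pi_ n u)].
    elim: M => [|M IH] MN; first by apply: filterS filterT => u _ n.
    have [V [Vx VQ]] := H M MN.
    apply: filterS (filterI (IH (ltnW MN)) (pi_cont MN Vx)) => u [H1 H2] n.
    rewrite ltnS leq_eqVlt => /orP[/eqP->|]; [exact: VQ|exact: H1].
  exact: (HM N).
move: HN; rewrite nbhsE /= => -[U Ux UQ].
by exists U; split=> // u n /UQ; apply.
Qed.

(* Since [omega^xi] is additively indecomposable, induction on [xi] suffices and
   no natural sum of the ranks of the components is needed. *)
Lemma deriv_iter_box xi (B : set P) (E : nat -> set T) x :
  (forall u n, B u -> (n < N)%N -> E n (pi_ n u)) ->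
  (forall u v, B u -> B v -> farP u v ->
     exists2 n, (n < N)%N & far (pi_ n u) (pi_ n v)) ->
  deriv_iter farP (omega_pow xi) B x ->
  exists2 n, (n < N)%N & deriv_iter far (omega_pow xi) (E n) (pi_ n x).
Proof.
elim: xi B E x => [|xi IH|J h f IH] B E x BE Bfar Hx.
- apply: contrapT => nx; case: Hx => /= Bx Hx.
  have HV : forall n, exists V, (n < N)%N -> nbhs (pi_ n x) V /\
     forall u v, V u -> E n u -> V v -> E n v -> ~ far u v.
    move=> n; have [nN|nN] := boolP (n < N)%N; last by exists setT.
    apply: contrapT => /forallNP nV; apply: nx; exists n => //=; split.
      exact: BE.
    move=> V Vx; apply: contrapT => nuv; apply: (nV V) => _; split=> // u v ? ? ? ? ?.
    by apply: nuv; exists u, v.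
  have [V VP] := choice HV.
  have [|U [Ux HU]] := @nbhs_box x V.
    by move=> n nN; exists (V n); split=> //; case: (VP n nN).
  have [|u [v [Ou Bu Ov Bv uv]]] := Hx U; first exact: open_nbhs_nbhs.
  have [n nN] := Bfar u v Bu Bv uv.
  have [_] := VP n nN; apply; [exact: HU|exact: BE|exact: HU|exact: BE].
- apply: contrapT => nx.
  (* [omega_pow (Osucc xi)] is the supremum of the finite multiples of [omega_pow xi], so each
     coordinate is already lost after some [k n] blocks. It remains to see that [x] is lost after as
     many blocks as the sum of the [k n], by induction on that sum. *)
  have Hk : forall n, exists k, (n < N)%N ->
      ~ deriv_iter far (omul (omega_pow xi) (onat k)) (E n) (pi_ n x).
    move=> n; have [nN|nN] := boolP (n < N)%N; last by exists 0%N.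
    apply: contrapT => /forallNP nk; apply: nx; exists n => // k _.
    by have /not_implyP[_ /contrapT] := nk k.
  have [k kP] := choice Hk.
  suff H m : forall (k : nat -> nat) x, (\sum_(n < N) k n <= m)%N ->
     (forall n, (n < N)%N ->
        ~ deriv_iter far (omul (omega_pow xi) (onat (k n))) (E n) (pi_ n x)) ->
     ~ deriv_iter farP (omul (omega_pow xi) (onat m)) B x.
    by apply: (H _ k x (leqnn _) kP); exact: Hx.
  elim: m {k kP Hk x nx Hx} => [|m IHm] k x km kP Hx.
    move: km; rewrite leqn0 sum_nat_eq0 => /forallP/(_ (Ordinal N0))/=/eqP k0.
    by apply: (kP _ N0); rewrite k0; exact: BE.
  have Bx : B x by exact: deriv_iter_sub Hx.
  have kpos n : (n < N)%N -> (0 < k n)%N.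
    by move=> nN; rewrite lt0n; apply/eqP => k0; apply: (kP _ nN); rewrite k0; exact: BE.
  have [|U [[oU Ux] HU]] := @nbhs_box x
    (fun n => [set t | ~ deriv_iter far (omul (omega_pow xi) (onat (k n))) (E n) t]).
    move=> n nN; have [V [Vx H]] := deriv_iter_relclosed (kP n nN) (BE _ _ Bx nN).
    by exists V; split; first exact: open_nbhs_nbhs.
  move: Hx; rewrite /= deriv_iter_add => Hx.
  have {}Hx := deriv_iter_localize oU (conj Hx Ux).
  (* A point of [U] that survives [m] blocks keeps every coordinate [n] alive for [k n - 1] blocks;
     otherwise the induction hypothesis applies with [k n] lowered by one. In the last block the
     sets [E n] may thus be replaced by these iterates, and the hypothesis on [xi] gives a
     coordinate that survives all [k n] blocks. *)
  have sub : forall u n, (deriv_iter farP (omul (omega_pow xi) (onat m)) B `&` U) u ->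
      (n < N)%N ->
      deriv_iter far (omul (omega_pow xi) (onat (k n).-1)) (E n) (pi_ n u).
    move=> u n [Bu Uu] nN; apply: contrapT => nu.
    apply: (IHm (fun i => if i == n then (k n).-1 else k i) u _ _ Bu).
      rewrite -ltnS; apply: leq_trans km.
      rewrite (bigD1 (Ordinal nN)) //= eqxx [ltnRHS](bigD1 (Ordinal nN)) //=.
      rewrite -addSn prednK ?kpos // leq_add2l; apply: leq_sum => i /= ii.
      by case: ifP => // /eqP ei; case/eqP: ii; exact: val_inj.
    by move=> i iN; case: eqP => [->//|_]; exact: HU.
  have [|n nN Hn] := IH _
    (fun n => deriv_iter far (omul (omega_pow xi) (onat (k n).-1)) (E n)) x sub _ Hx.
    by move=> u v [/deriv_iter_sub Bu _] [/deriv_iter_sub Bv _]; exact: Bfar.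
  apply: (kP _ nN); rewrite -(prednK (kpos _ nN)) /= deriv_iter_add.
  exact: Hn.
- apply: contrapT => nx.
  have Hk : forall n, exists i, (n < N)%N ->
      ~ deriv_iter far (omega_pow (f i)) (E n) (pi_ n x).
    move=> n; have [nN|nN] := boolP (n < N)%N; last by case: (h) => j; exists j.
    apply: contrapT => /forallNP nk; apply: nx; exists n => // k _.
    by have /not_implyP[_ /contrapT] := nk k.
  have [k kP] := choice Hk.
  (* Finitely many members of the family have a largest one, by totality of [ole]; a single stage
     then serves all coordinates. *)
  have [j Hj] : exists j, forall n, (n < N)%N ->
      ole (omega_pow (f (k n))) (omega_pow (f j)).
    elim: (N) => [|M [j Hj]]; first by exists (k 0%N).
    have [H|H] := ole_total (omega_pow (f (k M))) (omega_pow (f j)).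
      exists j => n; rewrite ltnS leq_eqVlt => /orP[/eqP->//|]; exact: Hj.
    exists (k M) => n; rewrite ltnS leq_eqVlt => /orP[/eqP->|/Hj Hn].
      exact: ole_refl.
    exact: ole_trans Hn H.
  have [n nN Hn] := IH j B E x BE Bfar (Hx j I).
  by apply: (kP n nN); exact: deriv_iter_anti (Hj n nN) _ Hn.
Qed.

End BoxLemma.

(** * Scalars and pointwise convergence *)

Section Scalars.
Context {R : realType} {s : scalars R}.
Local Notation K := (scalar_field s).

Definition scalar_of : R -> K :=
  match s return R -> scalar_field s with
  | RealScalars => id
  | ComplexScalars => real_complex R
  end.

Lemma scalar_ofD a b : scalar_of (a + b) = scalar_of a + scalar_of b.
Proof. by rewrite /scalar_of; destruct s => //=; rewrite rmorphD. Qed.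

Lemma scalar_ofM a b : scalar_of (a * b) = scalar_of a * scalar_of b.
Proof. by rewrite /scalar_of; destruct s => //=; rewrite rmorphM. Qed.

Lemma scalar_of1 : scalar_of 1 = 1.
Proof. by rewrite /scalar_of; destruct s. Qed.

Lemma scalar_of0 : scalar_of 0 = 0.
Proof. by rewrite /scalar_of; destruct s. Qed.

Lemma scalar_ofN a : scalar_of (- a) = - scalar_of a.
Proof. by rewrite /scalar_of; destruct s => //=; rewrite rmorphN. Qed.

Lemma scalar_of_le a b : (scalar_of a <= scalar_of b) = (a <= b).
Proof. by rewrite /scalar_of; destruct s => //=; rewrite lecR. Qed.

Lemma scalar_of_lt a b : (scalar_of a < scalar_of b) = (a < b).
Proof. by rewrite /scalar_of; destruct s => //=; rewrite ltcR. Qed.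

Lemma scalar_ofK a : scalar_Re (scalar_of a) = a.
Proof. by rewrite /scalar_of /scalar_Re; destruct s. Qed.

Lemma scalar_ReD (k l : K) : scalar_Re (k + l) = scalar_Re k + scalar_Re l.
Proof. by rewrite /scalar_Re; destruct s => //=; case: k l => [? ?] []. Qed.

Lemma scalar_ReN (k : K) : scalar_Re (- k) = - scalar_Re k.
Proof. by rewrite /scalar_Re; destruct s => //=; case: k. Qed.

Lemma scalar_Re_real t (k : K) : scalar_Re (scalar_of t * k) = t * scalar_Re k.
Proof.
rewrite /scalar_of /scalar_Re; destruct s => //=; case: k => a b /=.
by rewrite mul0r subr0.
Qed.

Lemma scalar_ReK (k : K) : 0 <= k -> scalar_of (scalar_Re k) = k.
Proof.
rewrite /scalar_of /scalar_Re; destruct s => //= k0.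
by rewrite RRe_real // ger0_real.
Qed.

Section Norm.
Context {V : normedModType K}.
Implicit Types x y : V.

Lemma rnormE x : `|x| = scalar_of (rnorm x).
Proof. by rewrite /rnorm scalar_ReK. Qed.

Lemma rnorm_ge0 x : 0 <= rnorm x.
Proof. by rewrite -scalar_of_le scalar_of0 -rnormE. Qed.

Lemma rnormD x y : rnorm (x + y) <= rnorm x + rnorm y.
Proof. by rewrite -scalar_of_le scalar_ofD -!rnormE ler_normD. Qed.

Lemma rnormN x : rnorm (- x) = rnorm x.
Proof. by rewrite /rnorm normrN. Qed.

Lemma rnorm0 : rnorm (0 : V) = 0.
Proof. by rewrite /rnorm normr0 -scalar_of0 scalar_ofK. Qed.

Lemma rnorm_eq0 x : rnorm x = 0 -> x = 0.
Proof. by move=> x0; apply/normr0_eq0; rewrite rnormE x0 scalar_of0. Qed.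

Lemma rnormB x y : rnorm (x - y) = rnorm (y - x).
Proof. by rewrite -rnormN opprB. Qed.

Lemma rnorm_triangle z x y : rnorm (x - y) <= rnorm (x - z) + rnorm (z - y).
Proof. by apply: le_trans (rnormD _ _); rewrite addrA subrK. Qed.

End Norm.

Lemma rnormZ (V : normedModType K) (k : K) (x : V) :
  rnorm (k *: x) = rnorm (k : K^o) * rnorm x.
Proof.
by rewrite -[RHS]scalar_ofK scalar_ofM -!rnormE /rnorm normrZ.
Qed.

Lemma rnormM (k l : K^o) : rnorm (k * l : K^o) = rnorm k * rnorm l.
Proof. exact: (rnormZ (V := K^o) k l). Qed.

Lemma rnorm_real (t : R) : rnorm (scalar_of t : K^o) = `|t|.
Proof.
rewrite /rnorm /scalar_of /scalar_Re; destruct s => //=.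
by rewrite /= expr0n addr0 sqrtr_sqr.
Qed.

Lemma rnorm1 : rnorm (1 : K^o) = 1.
Proof. by rewrite -[1 : K^o]scalar_of1 rnorm_real normr1. Qed.

Lemma scalar_Re_le (k : K^o) : scalar_Re k <= rnorm k.
Proof.
rewrite /rnorm /scalar_Re; destruct s => /=; first exact: ler_norm.
case: k => a b /=; apply: le_trans (ler_norm a) _.
by rewrite -sqrtr_sqr; apply: ler_wsqrtr; rewrite lerDl sqr_ge0.
Qed.

Lemma scalar_phase (k : K) : exists u : K,
  rnorm (u : K^o) = 1 /\ scalar_Re (u * k) = rnorm (k : K^o).
Proof.
have [->|k0] := eqVneq k 0.
  by exists 1; rewrite rnorm1 mulr0 (rnorm0 (V := K^o)) -scalar_of0 scalar_ofK.
have nk : rnorm (k : K^o) != 0.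
  by apply: contraNneq k0 => H; apply/eqP/(rnorm_eq0 (V := K^o)).
exists (scalar_of (rnorm (k : K^o)) / k); split; last first.
  by rewrite divfK // scalar_ofK.
rewrite (rnormM (scalar_of _) k^-1) rnorm_real ger0_norm ?rnorm_ge0 //.
rewrite -(rnormM k k^-1) /= mulfV //; exact: rnorm1.
Qed.

(** In the complex case [F v] is [l v - i l (i v)]. Real Hahn-Banach arguments thus serve both
    scalar fields. *)
Lemma complexify (V : lmodType K) (l : V -> R) :
  (forall u v, l (u + v) = l u + l v) ->
  (forall t v, l (scalar_of t *: v) = t * l v) ->
  exists F : V -> K^o, linear F /\ forall v, scalar_Re (F v) = l v.
Proof.
rewrite /scalar_of /scalar_Re; destruct s => /= lD lZ.
  exists l; split=> // a u v; by rewrite lD lZ.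
have lN u : l (- u) = - l u.
  by have := lZ (-1) u; rewrite rmorphN rmorph1 scaleN1r mulN1r.
exists (fun v => (l v) +i* (- l ('i%C *: v)))%C; split=> // -[a b] u v.
apply/eqP; rewrite eq_complex /=.
have E w : (a +i* b)%C *: w = (a%:C)%C *: w + (b%:C)%C *: ('i%C *: w).
  by rewrite scalerA -scalerDl; congr (_ *: _); simpc.
have Ei w : 'i%C *: ('i%C *: w) = - w :> V.
  by rewrite scalerA -expr2 sqr_i scaleN1r.
rewrite !E !scalerDr !lD !lZ.
have sw (t : R) w : 'i%C *: ((t%:C)%C *: w) = (t%:C)%C *: ('i%C *: w) :> V.
  by rewrite !scalerA mulrC.
rewrite !sw !Ei !lZ !lN.
by apply/andP; split; apply/eqP; ring.
Qed.

Lemma nbhs_rnorm (V : normedModType K) (x : V) (U : set V) : nbhs x U <->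
  exists2 d : R, 0 < d & forall y, rnorm (y - x) < d -> U y.
Proof.
split=> [|[d d0 H]].
  move/nbhs_ballP => [e /= e0 H]; exists (scalar_Re e).
    by rewrite -scalar_of_lt scalar_of0 scalar_ReK // ltW.
  move=> y xy; apply: H; rewrite -ball_normE /= distrC rnormE.
  by rewrite -[ltRHS](scalar_ReK (ltW e0)) scalar_of_lt.
apply/nbhs_ballP; exists (scalar_of d); first by rewrite /= -scalar_of0 scalar_of_lt.
move=> y; rewrite -ball_normE /= distrC rnormE scalar_of_lt; exact: H.
Qed.

(** Over the complex numbers [C] is the image of a square containing the disk. A compact superset is
    enough, since it is only used to enclose closed sets in a product. *)
Lemma scalar_ball_compact (r : R) : exists C : set K^o,
  compact C /\ forall k, rnorm k <= r -> C k.
Proof.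
have cR : compact [set` `[- r, r]] by exact: segment_compact.
rewrite /rnorm /scalar_Re; destruct s => /=.
  by exists [set` `[- r, r]]; split=> // k; rewrite ler_norml /= in_itv.
pose C : set (R * R) := [set` `[- r, r]] `*` [set` `[- r, r]].
have cC : compact C by exact: compact_setX.
exists ((fun ab : R * R => (ab.1 +i* ab.2)%C : (R[i]%C)^o) @` C).
split.
  apply: continuous_compact cC; apply: continuous_subspaceT => -[a b] U.
  move=> /nbhs_ballP[e /= e0 H].
  have ee : e = ((complex.Re e)%:C)%C by rewrite RRe_real // gtr0_real.
  move: e0; rewrite ee ltcR => e0; rewrite ee in H.
  have : nbhs (a, b) (ball a (complex.Re e / 2) `*` ball b (complex.Re e / 2)).
    by exists (ball a (complex.Re e / 2), ball b (complex.Re e / 2)) => //=; split;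
      apply: nbhsx_ballx; rewrite divr_gt0.
  apply: filterS => -[c d] /= [ac bd]; apply: H.
  rewrite -ball_normE /= ltcR.
  have : `|a - c| + `|b - d| < complex.Re e by rewrite [ltRHS]splitr ltrD.
  apply: le_lt_trans; rewrite -[leRHS]ger0_norm ?addr_ge0 // -sqrtr_sqr.
  apply: ler_wsqrtr; rewrite [leRHS]sqrrD !real_normK ?num_real //.
  by rewrite -addrA [_ *+ 2 + _]addrC addrA lerDl mulrn_wge0 // mulr_ge0.
case=> a b /= ab; exists (a, b) => //=.
have h (x y : R) : Num.sqrt (x ^+ 2 + y ^+ 2) <= r -> (- r <= x <= r).
  move=> H; rewrite -ler_norml; apply: le_trans H.
  by rewrite -sqrtr_sqr; apply: ler_wsqrtr; rewrite lerDl sqr_ge0.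
by split; rewrite /= in_itv /=; [exact: h ab|apply: (h b a); rewrite addrC].
Qed.

End Scalars.

Section Pointwise.
Context {R : realType} {s : scalars R}.
Local Notation K := (scalar_field s).
Context {I : eqType}.
Implicit Types (p q : {ptws I -> K^o}).

Lemma nbhs_ptws_coord p i (d : R) : 0 < d ->
  nbhs p [set q : {ptws I -> K^o} | rnorm (q i - p i) < d].
Proof.
move=> d0.
have := @proj_continuous I (fun=> K^o : topologicalType) i p
  [set k : K^o | rnorm (k - p i) < d].
by apply; apply/nbhs_rnorm; exists d.
Qed.

Lemma nbhs_ptwsP p (V : set {ptws I -> K^o}) : nbhs p V ->
  exists (l : seq I) (d : R), 0 < d /\
    forall q, (forall i, i \in l -> rnorm (q i - p i) < d) -> V q.
Proof.
(* The sets containing a basic neighborhood of [p] form a filter. That it converges to [p] can be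
   tested one coordinate at a time, and convergence says that it contains all neighborhoods of
   [p]. *)
pose F : set_system {ptws I -> K^o} := [set V | exists (l : seq I) (d : R), 0 < d /\
    forall q, (forall i, i \in l -> rnorm (q i - p i) < d) -> V q].
have FF : Filter F.
  constructor; first by exists [::], 1.
  - move=> U W [l [d [d0 H]]] [l' [d' [d'0 H']]].
    exists (l ++ l'), (Num.min d d'); split; first by rewrite lt_min d0.
    move=> q Hq; split; [apply: H|apply: H'] => i il.
      by have := Hq i; rewrite mem_cat il lt_min => /(_ isT)/andP[].
    by have := Hq i; rewrite mem_cat il orbT lt_min => /(_ isT)/andP[].
  - move=> U W UW [l [d [d0 H]]]; exists l, d; split=> // q /H; exact: UW.
suff : F --> p by exact.
apply/cvg_sup => i A /= [_ [[W oW <-] Wp WA]].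
have /nbhs_rnorm[d d0 H] : nbhs (p i) W by exact: open_nbhs_nbhs.
exists [:: i], d; split=> // q Hq; apply: WA; apply: H; apply: Hq.
by rewrite inE.
Qed.

Lemma nbhs_ptws_coords p (l : seq I) (d : R) : 0 < d ->
  nbhs p [set q : {ptws I -> K^o} | forall i, i \in l -> rnorm (q i - p i) < d].
Proof.
move=> d0; elim: l => [|i l IH]; first by apply: filterS filterT => q _ i.
apply: filterS (filterI (nbhs_ptws_coord p i d0) IH) => q [qi ql] j.
by rewrite inE => /orP[/eqP->|]; [exact: qi|exact: ql].
Qed.

Lemma nbhs_ptws_map (J : eqType) (u : I -> {ptws J -> K^o} -> K^o)
    (q : {ptws J -> K^o}) (V : set {ptws I -> K^o}) :
  (forall i d, 0 < d -> nbhs q [set q' | rnorm (u i q' - u i q) < d]) ->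
  nbhs ((fun i => u i q) : {ptws I -> K^o}) V ->
  nbhs q [set q' | V (fun i => u i q')].
Proof.
move=> Hu /nbhs_ptwsP[l [d [d0 H]]].
have : nbhs q [set q' | forall i, i \in l -> rnorm (u i q' - u i q) < d].
  elim: l {H} => [|i l IH]; first by apply: filterS filterT => q' _ i.
  apply: filterS (filterI (Hu i d d0) IH) => q' [qi ql] j.
  by rewrite inE => /orP[/eqP->|]; [exact: qi|exact: ql].
by apply: filterS => q' Hq'; exact: H.
Qed.

(** Tychonoff's theorem, in the way it yields Banach-Alaoglu. *)
Lemma ptws_subcompact (r : I -> R) (S : set {ptws I -> K^o}) : closed S ->
  (forall p i, S p -> rnorm (p i) <= r i) -> compact S.
Proof.
move=> cS Sr.
have [C HC] := choice (fun i => @scalar_ball_compact R s (r i)).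
apply: (subclosed_compact cS (tychonoff (fun i => (HC i).1))).
by move=> p Sp i; apply: (HC i).2; exact: Sr.
Qed.

End Pointwise.

(** * Hahn-Banach and duals of maxima of seminorms *)

Section LinearPredicate.
Context {F : pzRingType} {U V : lmodType F} {f : U -> V}.
Hypothesis f_linear : linear f.

Lemma linear_predD u v : f (u + v) = f u + f v.
Proof. by have := f_linear 1 u v; rewrite !scale1r. Qed.

Lemma linear_pred0 : f 0 = 0.
Proof. by apply: (addrI (f 0)); rewrite -linear_predD !addr0. Qed.

Lemma linear_predZ a u : f (a *: u) = a *: f u.
Proof. by have := f_linear a u 0; rewrite linear_pred0 !addr0. Qed.

Lemma linear_predB u v : f (u - v) = f u - f v.
Proof. by rewrite -[- v]scaleN1r linear_predD linear_predZ scaleN1r. Qed.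

End LinearPredicate.

Section HahnBanach.
Context {R : realType} {s : scalars R}.
Local Notation K := (scalar_field s).
Local Notation "t ** v" := (@scalar_of R s t *: v) (at level 40).

Definition sublinear (V : lmodType K) (q : V -> R) :=
  (forall u v, q (u + v) <= q u + q v) /\
  (forall t v, 0 <= t -> q (t ** v) <= t * q v).

Definition real_linear (V : lmodType K) (l : V -> R) :=
  (forall u v, l (u + v) = l u + l v) /\ (forall t v, l (t ** v) = t * l v).

Definition seminorm (V : lmodType K) (h : V -> R) :=
  (forall u v, h (u + v) <= h u + h v) /\
  (forall (k : K) v, h (k *: v) = rnorm (k : K^o) * h v).

Section Seminorm.
Context {V : lmodType K} {h : V -> R}.
Hypothesis hh : seminorm h.

Lemma seminorm0 : h 0 = 0.
Proof. by rewrite -(scale0r 0) hh.2 (rnorm0 (V := K^o)) mul0r. Qed.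

Lemma seminormN v : h (- v) = h v.
Proof. by rewrite -scaleN1r hh.2 (rnormN (V := K^o)) rnorm1 mul1r. Qed.

Lemma seminorm_ge0 v : 0 <= h v.
Proof.
by have := hh.1 v (- v); rewrite subrr seminorm0 seminormN -mulr2n pmulrn_lge0.
Qed.

Lemma seminorm_sublinear : sublinear h.
Proof.
by split=> [|t v t0]; [exact: hh.1|rewrite hh.2 rnorm_real ger0_norm].
Qed.

End Seminorm.

Lemma seminormZl (V : lmodType K) (h : V -> R) c : 0 <= c -> seminorm h ->
  seminorm (fun v => c * h v).
Proof.
move=> c0 [hD hZ]; split=> [u v|k v]; first by rewrite -mulrDr ler_wpM2l.
by rewrite hZ mulrCA.
Qed.

Lemma sublinear0 (V : lmodType K) (q : V -> R) : sublinear q -> q 0 = 0.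
Proof.
move=> [qD qZ]; apply/eqP; rewrite eq_le; apply/andP; split.
  by have := qZ 0 0 (lexx 0); rewrite scaler0 mul0r.
by have := qD 0 0; rewrite addr0 lerDl.
Qed.

Lemma sublinear_pos (V : lmodType K) (q : V -> R) t v : sublinear q -> 0 <= t ->
  q (t ** v) = t * q v.
Proof.
move=> sq; rewrite le_eqVlt => /predU1P[<-|t0].
  by rewrite scalar_of0 scale0r mul0r sublinear0.
apply/eqP; rewrite eq_le (sq.2 _ _ (ltW t0)) /=.
have := sq.2 t^-1 (t ** v); rewrite invr_ge0 ltW // => /(_ isT).
by rewrite scalerA -scalar_ofM mulVf ?gt_eqF // scalar_of1 scale1r [t^-1 * _]mulrC
  ler_pdivlMr // [_ * t]mulrC.
Qed.

(* With a ray for [S] this shows that minimal sublinear functionals are linear,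
   with the graph of a functional for [S] it extends that functional. *)
Lemma sublinear_shift (V : lmodType K) (q : V -> R) (S : V -> R -> Prop) :
  sublinear q -> S 0 0 ->
  (forall x y c d, S x c -> S y d -> S (x + y) (c + d)) ->
  (forall t x c, 0 < t -> S x c -> S (t ** x) (t * c)) ->
  (forall x c, S x c -> c <= q x) ->
  exists p, [/\ sublinear p, forall v, p v <= q v &
    forall v x c, S x c -> p v <= q (v + x) - c].
Proof.
move=> sq S0 SD SZ Sq.
pose E v := [set r | exists x c, S x c /\ r = q (v + x) - c].
have lbE v : lbound (E v) (- q (- v)).
  move=> _ [x [c [Sx ->]]]; have := sq.1 (v + x) (- v); have := Sq _ _ Sx.
  by rewrite [v + x]addrC addrK; lra.
have hiE v : has_inf (E v).
  by split; [exists (q (v + 0) - 0), 0, 0|exists (- q (- v))].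
have infE v x c : S x c -> inf (E v) <= q (v + x) - c.
  by move=> Sx; apply: inf_lbound; [exact: (hiE v).2|exists x, c].
have geE v y : (forall x c, S x c -> y <= q (v + x) - c) -> y <= inf (E v).
  move=> H; apply: lb_le_inf; first exact: (hiE v).1.
  by move=> _ [x [c [Sx ->]]]; exact: H.
exists (fun v => inf (E v)); split=> //; last first.
  by move=> v; have := infE v 0 0 S0; rewrite addr0 subr0.
split=> [u v|t v] /=.
  rewrite -lerBlDr; apply: (geE u) => x c Sx; rewrite lerBlDr -lerBlDl.
  apply: (geE v) => y d Sy; rewrite lerBlDl; apply: le_trans (infE _ _ _ (SD _ _ _ _ Sx Sy)) _.
  have := sq.1 (u + x) (v + y); rewrite addrACA; lra.
rewrite le_eqVlt => /predU1P[<-|t0].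
  have := infE (0 ** v) 0 0 S0; rewrite scalar_of0 scale0r mul0r addr0 subr0.
  by rewrite sublinear0.
rewrite mulrC -ler_pdivrMr //; apply: geE => x c Sx; rewrite ler_pdivrMr //.
apply: le_trans (infE _ _ _ (SZ _ _ _ t0 Sx)) _.
by rewrite -scalerDr (sublinear_pos _ sq (ltW t0)) -mulrBr mulrC.
Qed.

(** Zorn's lemma gives a minimal sublinear functional below [q]. It is additive, since shifting it
    along a ray would otherwise produce a smaller one. *)
Lemma sublinear_minorant (V : lmodType K) (q : V -> R) : sublinear q ->
  exists l, real_linear l /\ forall v, l v <= q v.
Proof.
move=> sq; pose T := {p : V -> R | sublinear p /\ forall v, p v <= q v}.
pose mkT p (sp : sublinear p) (pq : forall v, p v <= q v) : T :=
  exist (fun p => sublinear p /\ forall v, p v <= q v) p (conj sp pq).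
pose q0 : T := mkT q sq (fun v => lexx _).
(* The order is reversed, so that a maximal element for [below] is a minimal functional. *)
pose below (p p' : T) := `[< forall v, sval p' v <= sval p v >].
have [|a b c /asboolP ab /asboolP bc|A totA|[p [sp pq]] pmin] :=
  @ZL_preorder T q0 below.
- by move=> p; apply/asboolP => v.
- by apply/asboolP => v; exact: le_trans (bc v) (ab v).
- have [[a0 Aa0]|nA] := pselect (exists a, A a); last first.
    by exists q0 => a Aa; case: nA; exists a.
  pose E v := [set r | exists2 a : T, A a & r = sval a v].
  have lbE v : lbound (E v) (- q (- v)).
    move=> _ [[p [sp pq]] _ ->] /=; rewrite lerNl; apply: le_trans (pq (- v)).
    by have := sp.1 v (- v); rewrite subrr sublinear0 // -lerBlDl sub0r.
  have hiE v : has_inf (E v).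
    by split; [exists (sval a0 v), a0|exists (- q (- v))].
  have infE v a : A a -> inf (E v) <= sval a v.
    by move=> Aa; apply: inf_lbound; [exact: (hiE v).2|exists a].
  have geE v y : (forall a, A a -> y <= sval a v) -> y <= inf (E v).
    move=> H; apply: lb_le_inf; first exact: (hiE v).1.
    by move=> _ [a Aa ->]; exact: H.
  have sE : sublinear (fun v => inf (E v)).
    split=> [u v|t v t0] /=.
      rewrite -lerBlDr; apply: (geE u) => a Aa; rewrite lerBlDr -lerBlDl.
      apply: (geE v) => b Ab; rewrite lerBlDl.
      (* An infimum of sublinear functionals need not be subadditive; along a chain it is, because
         two members have a common lower one. *)
      have [c [Ac ca cb]] : exists c, [/\ A c, forall v, sval c v <= sval a v &
          forall v, sval c v <= sval b v].
        by case: (totA a b Aa Ab) => /asboolP H; [exists b|exists a].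
      apply: le_trans (infE _ _ Ac) _.
      by apply: le_trans ((svalP c).1.1 u v) _; rewrite lerD.
    move: t0; rewrite le_eqVlt => /predU1P[<-|t0].
      rewrite mul0r; apply: le_trans (infE _ _ Aa0) _.
      by rewrite scalar_of0 scale0r sublinear0 //; exact: (svalP a0).1.
    rewrite mulrC -ler_pdivrMr //; apply: geE => a Aa; rewrite ler_pdivrMr //.
    apply: le_trans (infE _ _ Aa) _; rewrite mulrC.
    exact: (svalP a).1.2 (ltW t0).
  have Eq v : inf (E v) <= q v by apply: le_trans (infE _ _ Aa0) ((svalP a0).2 v).
  by exists (mkT _ sE Eq) => a Aa; apply/asboolP => v; exact: infE.
have pD a v : p v + p a <= p (v + a).
  (* The ray through [a] with the values of [p]. The shifted functional [p'] is at most [p v], hence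
     equal to it by minimality, and at most [p (v + a) - p a]. *)
  pose S x c := exists2 t : R, 0 <= t & x = t ** a /\ c = t * p a.
  have [||||p' [sp' p'p Hp']] := @sublinear_shift V p S sp.
  - by exists 0; rewrite // scalar_of0 scale0r mul0r.
  - move=> x y c d [t t0 [-> ->]] [t' t'0 [-> ->]]; exists (t + t').
      exact: addr_ge0.
    by rewrite scalar_ofD scalerDl mulrDl.
  - move=> t x c t0 [t' t'0 [-> ->]]; exists (t * t').
      by rewrite mulr_ge0 // ltW.
    by rewrite scalerA -scalar_ofM mulrA.
  - by move=> x c [t t0 [-> ->]]; rewrite sublinear_pos.
  have p'q v' : p' v' <= q v' by exact: le_trans (p'p v') (pq v').
  have /asboolP/(_ v)/= := pmin (mkT p' sp' p'q) (asboolT p'p).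
  move=> pp'; rewrite -lerBrDr; apply: le_trans pp' _; apply: Hp'.
  by exists 1; rewrite ?scalar_of1 ?scale1r ?mul1r.
have {}pD u v : p (u + v) = p u + p v.
  by apply/eqP; rewrite eq_le sp.1 pD.
have pN v : p (- v) = - p v.
  by apply: (addIr (p v)); rewrite -pD !addNr sublinear0.
exists p; split=> //; split=> // t v.
have [t0|t0] := leP 0 t; first exact: sublinear_pos.
rewrite -[t in LHS]opprK scalar_ofN scaleNr pN sublinear_pos ?mulNr ?opprK //.
by rewrite oppr_ge0 ltW.
Qed.

Lemma real_linearN (V : lmodType K) (l : V -> R) v : real_linear l ->
  l (- v) = - l v.
Proof.
by move=> [_ lZ]; have := lZ (- 1) v; rewrite scalar_ofN scalar_of1 scaleN1r mulN1r.
Qed.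

(** Shift [q] by the graph of [phi] and take a linear minorant; the shift makes it dominate [phi]
    along [D], and the sign change [w] to [-w] gives equality. A map [D] instead of a subspace
    covers both uses: the diagonal of a power of [V] and the inclusion of Z into Y. *)
Lemma hahn_banach (V W : lmodType K) (D : {linear W -> V}) (q : V -> R)
    (phi : W -> R) : sublinear q -> real_linear phi ->
  (forall w, phi w <= q (D w)) ->
  exists l, [/\ real_linear l, forall v, l v <= q v & forall w, l (D w) = phi w].
Proof.
move=> sq lphi phiq.
have [||||p [sp pq Hp]] := @sublinear_shift V q
    (fun x c => exists2 w, x = D w & c = phi w) sq.
- exists 0; first by rewrite linear0.
  by have := lphi.2 0 0; rewrite scaler0 mul0r.
- move=> x y c d [w -> ->] [w' -> ->]; exists (w + w'); first by rewrite linearD.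
  by rewrite lphi.1.
- move=> t x c t0 [w -> ->]; exists (t ** w); first by rewrite linearZ.
  by rewrite lphi.2.
- by move=> x c [w -> ->].
have [l [ll lp]] := sublinear_minorant sp.
exists l; split=> // [v|w]; first exact: le_trans (lp v) (pq v).
have H w' : phi w' <= l (D w').
  rewrite -lerN2 -real_linearN //; apply: le_trans (lp _) _.
  apply: le_trans (Hp _ (D w') _ _) _; first by exists w'.
  by rewrite addNr sublinear0 // sub0r.
apply/eqP; rewrite eq_le H andbT -lerN2 -!real_linearN // -linearN; exact: H.
Qed.

Lemma rnorm_le_Re (V : lmodType K) (F : V -> K^o) (h : V -> R) v :
  linear F -> seminorm h -> (forall v, scalar_Re (F v) <= h v) ->
  rnorm (F v) <= h v.
Proof.
move=> linF hh Fh; have [u [u1 uF]] := scalar_phase (F v).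
rewrite -uF -[h v]mul1r -u1 -hh.2; apply: le_trans (Fh _).
by rewrite linear_predZ.
Qed.

Lemma real_linear_Re (V : lmodType K) (F : V -> K^o) : linear F ->
  real_linear (fun v => scalar_Re (F v)).
Proof.
move=> linF; split=> [u v|t v]; first by rewrite linear_predD // scalar_ReD.
by rewrite linear_predZ // -scalar_Re_real.
Qed.

Lemma hahn_banach_seminorm (V W : lmodType K) (D : {linear W -> V}) (h : V -> R)
    (F : W -> K^o) : seminorm h -> linear F -> (forall w, rnorm (F w) <= h (D w)) ->
  exists G : V -> K^o, [/\ linear G, forall v, rnorm (G v) <= h v &
    forall w, G (D w) = F w].
Proof.
move=> hh linF Fh.
have [|l [ll lh lD]] := @hahn_banach V W D h (fun w => scalar_Re (F w))
  (seminorm_sublinear hh) (real_linear_Re linF).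
  by move=> w; exact: le_trans (scalar_Re_le _) (Fh w).
have [G [linG ReG]] := complexify ll.1 ll.2.
exists G; split=> // [v|w].
  by apply: rnorm_le_Re => // v'; rewrite ReG.
apply/eqP; rewrite -subr_eq0; apply/eqP/(rnorm_eq0 (V := K^o)).
have [u [_ <-]] := scalar_phase (G (D w) - F w).
rewrite mulrBr scalar_ReD scalar_ReN.
have -> : u * G (D w) = G (D (u *: w)) by rewrite linearZ linear_predZ.
have -> : u * F w = F (u *: w) by rewrite linear_predZ.
by rewrite ReG lD subrr.
Qed.

(** The dual of a finite sup-sum is the l_1-sum of the duals: view [f] as a functional on the
    diagonal of the [M]-th power of [V] under the maximum of the [h i], extend it, and restrict the
    extension to each factor. *)
Lemma dual_max_decomposition (V : lmodType K) M (h : 'I_M -> V -> R) (f : V -> K^o) :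
  (forall i, seminorm (h i)) -> linear f ->
  (forall v t, 0 <= t -> (forall i, h i v <= t) -> rnorm (f v) <= t) ->
  exists (c : 'I_M -> R) (F : 'I_M -> V -> K^o),
    [/\ forall i, 0 <= c i, \sum_i c i <= 1, forall i, linear (F i),
        forall i v, rnorm (F i v) <= c i * h i v & forall v, f v = \sum_i F i v].
Proof.
move=> hh linf fh.
pose W : lmodType K := {ffun 'I_M -> V}.
pose q (u : {ffun 'I_M -> V}) := \big[Num.max/0]_i h i (u i).
have hq (u : {ffun 'I_M -> V}) i : h i (u i) <= q u by rewrite /q (bigD1 i) //= le_max lexx.
have qh (u : {ffun 'I_M -> V}) t : 0 <= t -> (forall i, h i (u i) <= t) -> q u <= t.
  by move=> t0 ht; rewrite /q; elim/big_ind: _ => // x y xt yt; rewrite ge_max xt.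
have q0 u : 0 <= q u.
  by rewrite /q; elim/big_ind: _ => // [x y x0 y0|i _]; rewrite ?le_max ?x0 ?seminorm_ge0.
have sq : sublinear q.
  split=> [u v|t v t0]; (apply: qh => [|i]; first by rewrite ?addr_ge0 ?mulr_ge0).
    by rewrite ffunE; apply: le_trans ((hh i).1 _ _) _; rewrite lerD.
  rewrite ffunE; apply: le_trans ((seminorm_sublinear (hh i)).2 _ _ t0) _.
  by rewrite ler_wpM2l.
pose D (v : V) : {ffun 'I_M -> V} := [ffun=> v].
have linD : linear (D : V -> W) by move=> a u v; apply/ffunP => i; rewrite !ffunE.
pose mD := GRing.isLinear.Build K V W *:%R D linD.
pose D' : {linear V -> W} := HB.pack D mD.
have [|l [ll lq lD]] := @hahn_banach W V D' q (fun v => scalar_Re (f v)) sq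
    (real_linear_Re linf).
  move=> w; apply: le_trans (scalar_Re_le _) (fh _ _ (q0 _) _) => i.
  by have := hq (D w) i; rewrite ffunE.
pose e i (v : V) : {ffun 'I_M -> V} := [ffun j => if j == i then v else 0].
have eD i u v : e i (u + v) = e i u + e i v.
  by apply/ffunP => j; rewrite !ffunE; case: ifP => //; rewrite addr0.
have eZ i k v : e i (k *: v) = k *: e i v.
  by apply/ffunP => j; rewrite !ffunE; case: ifP => //; rewrite scaler0.
have lsum (I : Type) (r : seq I) (P : pred I) (u : I -> W) :
    l (\sum_(i <- r | P i) u i) = \sum_(i <- r | P i) l (u i).
  apply: (big_morph l ll.1).
  by have := ll.2 0 0; rewrite scaler0 mul0r.
have sume (v : 'I_M -> V) : \sum_i e i (v i) = [ffun i => v i].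
  apply/ffunP => j; rewrite sum_ffunE ffunE (bigD1 j) //= ffunE eqxx big1 ?addr0 //.
  by move=> i ij; rewrite ffunE eq_sym (negbTE ij).
have le i v : l (e i v) <= h i v.
  apply: le_trans (lq _) (qh _ _ (seminorm_ge0 (hh i) v) _) => j; rewrite ffunE.
  by case: eqP => [->//|_]; rewrite (seminorm0 (hh j)) (seminorm_ge0 (hh i)).
(* [sup (S i)] is the norm of the restriction of [l] to the factor [i], measured by [h i]; it
   becomes the weight [c i]. *)
pose S i := [set r | exists2 v, h i v <= 1 & r = l (e i v)].
have hS i : has_sup (S i).
  split; first by exists (l (e i 0)), 0 => //; rewrite (seminorm0 (hh i)).
  by exists 1 => _ [v hv ->]; exact: le_trans (le i v) hv.
have supS i v : h i v <= 1 -> l (e i v) <= sup (S i).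
  by move=> hv; apply: sup_upper_bound => //; exists v.
have c0 i : 0 <= sup (S i).
  have := supS i 0; rewrite (seminorm0 (hh i)) ler01 => /(_ isT).
  suff -> : l (e i 0) = 0 by [].
  by have := ll.2 0 (e i 0); rewrite -eZ scaler0 mul0r.
have lc i v : l (e i v) <= sup (S i) * h i v.
  have := seminorm_ge0 (hh i) v; rewrite le_eqVlt => /predU1P[h0|h0].
    by rewrite -h0 mulr0 h0.
  rewrite -ler_pdivrMr // mulrC -ll.2 -eZ; apply: supS.
  rewrite (sublinear_pos _ (seminorm_sublinear (hh i))) ?invr_ge0 ?(ltW h0) //.
  by rewrite mulVf ?gt_eqF.
have liR i : real_linear (fun v => l (e i v)).
  by split=> [u v|t v]; rewrite ?eD ?eZ ?ll.1 ?ll.2.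
have [F HF] := choice (fun i => complexify (liR i).1 (liR i).2).
exists (fun i => sup (S i)), F; split=> [//||i|i v|v].
(* Near-maximizers in the separate factors assemble into one vector with [q] at most 1, so the
   weights sum to at most [1 + d]. Dividing by [M.+1] avoids a case distinction for [M = 0]. *)
- apply/ler_addgt0Pr => d d0.
  have M0 : 0 < M.+1%:R :> R by rewrite ltr0n.
  have Hv i : exists v, h i v <= 1 /\ sup (S i) - d / M.+1%:R < l (e i v).
    have [|_ [v hv ->] lv] := @sup_adherent _ (S i) (d / M.+1%:R) _ (hS i).
      exact: divr_gt0.
    by exists v.
  have [v vP] := choice Hv.
  have : \sum_i l (e i (v i)) <= 1.
    rewrite -lsum sume; apply: le_trans (lq _) (qh _ _ ler01 _) => i.
    by rewrite ffunE; exact: (vP i).1.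
  have : \sum_i (sup (S i) - d / M.+1%:R) <= \sum_i l (e i (v i)).
    by apply: ler_sum => i _; exact: ltW (vP i).2.
  rewrite sumrB sumr_const card_ord -[_ *+ M]mulr_natr.
  have : d / M.+1%:R * M%:R <= d.
    by rewrite -mulrA ler_piMr ?ltW // mulrC ltr_pdivrMr // mul1r ltr_nat.
  move=> H1 H2 H3 /=; rewrite -lerBlDr; apply: le_trans H3.
  by apply: le_trans H2; rewrite lerB.
- exact: (HF i).1.
- apply: (@rnorm_le_Re V (F i) (fun v => sup (S i) * h i v)); first exact: (HF i).1.
    exact: seminormZl.
  by move=> w; rewrite (HF i).2.
- apply/eqP; rewrite -subr_eq0; apply/eqP/(rnorm_eq0 (V := K^o)).
  have [k [_ <-]] := scalar_phase (f v - \sum_i F i v).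
  rewrite mulrBr scalar_ReD scalar_ReN mulr_sumr.
  have -> : k * f v = f (k *: v) by rewrite (linear_predZ linf).
  have -> : scalar_Re (\sum_i k * F i v) = \sum_i l (e i (k *: v)).
    rewrite (big_morph _ scalar_ReD (_ : _ = 0)).
      apply: eq_bigr => i _; rewrite -(HF i).2; congr scalar_Re.
      by rewrite (linear_predZ (HF i).1).
    by rewrite -scalar_of0 scalar_ofK.
  by rewrite -lsum sume -(lD (k *: v)) subrr.
Qed.

End HahnBanach.

(** * The interpolation space *)

Section KFunctional.
Context {R : realType} {s : scalars R}.
Local Notation K := (scalar_field s).
Variables (X Y : completeNormedModType K) (A : {linear X -> Y}).

(** This is the gauge of the convex hull of [2^n A(B_X)] and [2^-n B_Y], as in the
    Davis-Figiel-Johnson-Pelczynski construction; written as an infimum it is visibly a seminorm. *)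
Definition kfun (n : nat) (y : Y) : R :=
  inf [set 2 ^+ n * rnorm (y - A x) + 2 ^- n * rnorm x | x in [set: X]].

Let has_inf_kfun n y :
  has_inf [set 2 ^+ n * rnorm (y - A x) + 2 ^- n * rnorm x | x in [set: X]].
Proof.
split; first by exists (2 ^+ n * rnorm (y - A 0) + 2 ^- n * rnorm (0 : X)), 0.
exists 0 => _ [x _ <-].
by rewrite addr_ge0 // mulr_ge0 ?rnorm_ge0 ?invr_ge0 ?exprn_ge0.
Qed.

Lemma kfun_le n y x : kfun n y <= 2 ^+ n * rnorm (y - A x) + 2 ^- n * rnorm x.
Proof. by apply: inf_lbound; [exact: (has_inf_kfun n y).2|exists x]. Qed.

Lemma le_kfun n y t :
  (forall x, t <= 2 ^+ n * rnorm (y - A x) + 2 ^- n * rnorm x) -> t <= kfun n y.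
Proof.
move=> H; apply: lb_le_inf; first exact: (has_inf_kfun n y).1.
by move=> _ [x _ <-]; exact: H.
Qed.

Lemma kfun_lt n y t : kfun n y < t ->
  exists x, 2 ^+ n * rnorm (y - A x) + 2 ^- n * rnorm x < t.
Proof.
move=> /(inf_lt (has_inf_kfun n y).1)[_ [x _ <-] xt].
by exists x.
Qed.

Lemma kfun_le_norm n y : kfun n y <= 2 ^+ n * rnorm y.
Proof. by have := kfun_le n y 0; rewrite linear0 subr0 rnorm0 mulr0 addr0. Qed.

Lemma kfun_image n x : kfun n (A x) <= 2 ^- n * rnorm x.
Proof. by have := kfun_le n (A x) x; rewrite subrr rnorm0 mulr0 add0r. Qed.

Lemma kfun_seminorm n : seminorm (kfun n).
Proof.
have H0 : 0 <= kfun n 0.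
  by apply: le_kfun => x; rewrite addr_ge0 // mulr_ge0 ?rnorm_ge0 ?invr_ge0 ?exprn_ge0.
have Z (k : K) v : kfun n (k *: v) <= rnorm (k : K^o) * kfun n v.
  have [k0|k0] := eqVneq (rnorm (k : K^o)) 0.
    rewrite k0 (rnorm_eq0 (V := K^o) k0) scale0r mul0r.
    by have := kfun_le_norm n 0; rewrite rnorm0 mulr0.
  have k1 : 0 < rnorm (k : K^o) by rewrite lt_def k0 (rnorm_ge0 (V := K^o)).
  rewrite mulrC -ler_pdivrMr //; apply: le_kfun => x; rewrite ler_pdivrMr //.
  apply: le_trans (kfun_le _ _ (k *: x)) _.
  by rewrite linearZ -scalerBr !rnormZ; rewrite le_eqVlt; apply/predU1P; left; ring.
split=> [u v|k v].
  rewrite -lerBlDr; apply: le_kfun => x; rewrite lerBlDr -lerBlDl.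
  apply: le_kfun => x'; rewrite lerBlDl.
  apply: le_trans (kfun_le _ _ (x + x')) _.
  rewrite linearD opprD addrACA.
  have e1 : 0 <= 2 ^+ n :> R by rewrite exprn_ge0.
  have e2 : 0 <= 2 ^- n :> R by rewrite invr_ge0 exprn_ge0.
  have := ler_wpM2l e1 (rnormD (u - A x) (v - A x')).
  by have := ler_wpM2l e2 (rnormD x x'); lra.
apply/eqP; rewrite eq_le Z /=.
have [->|k0] := eqVneq k 0; first by rewrite scale0r (rnorm0 (V := K^o)) mul0r.
have := Z k^-1 (k *: v); rewrite scalerA mulVf // scale1r.
have k1 : rnorm (k^-1 : K^o) * rnorm (k : K^o) = 1.
  by rewrite -(rnormM k^-1 k) /= mulVf // rnorm1.
move=> /(ler_wpM2l (rnorm_ge0 (k : K^o))); rewrite mulrA.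
by rewrite [_ * rnorm (k^-1 : K^o)]mulrC k1 mul1r.
Qed.

Definition kfun_vanish : {pred Y} :=
  fun y => `[< forall e : R, 0 < e -> exists N, forall n, (N <= n)%N -> kfun n y <= e >].

Lemma kfun_vanish_submod : submod_closed kfun_vanish.
Proof.
split=> [|k u v /asboolP Hu /asboolP Hv]; apply/asboolP => e e0.
  exists 0%N => n _; rewrite (seminorm0 (kfun_seminorm n)); exact: ltW.
have k0 : 0 < rnorm (k : K^o) + 1 by rewrite ltr_wpDl // (rnorm_ge0 (V := K^o)).
have [|N HN] := Hu (e / 2 / (rnorm (k : K^o) + 1)); first by rewrite !divr_gt0.
have [|M HM] := Hv (e / 2); first by rewrite divr_gt0.
exists (maxn N M) => n; rewrite geq_max => /andP[/HN nu /HM nv].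
apply: le_trans ((kfun_seminorm n).1 _ _) _; rewrite (kfun_seminorm n).2 [e]splitr.
rewrite lerD //; move: nu; rewrite ler_pdivlMr //; apply: le_trans.
by rewrite mulrC ler_wpM2l ?lerDl // (seminorm_ge0 (kfun_seminorm n)).
Qed.

HB.instance Definition _ := GRing.isSubmodClosed.Build K Y kfun_vanish
  kfun_vanish_submod.

End KFunctional.

Section InterpolationSpace.
Context {R : realType} {s : scalars R}.
Local Notation K := (scalar_field s).
Variables (X Y : completeNormedModType K) (A : {linear X -> Y}).
Hypothesis A_bounded : bounded_map A.

Local Notation g := (kfun A).

(** Write [y = (y - A x) + A x] and bound [A x] by the bound of [A]. As the norm of Z dominates
    [g 0], it separates points and the inclusion into Y is bounded. *)
Lemma kfun0_norm : exists2 C : R, 0 < C & forall y, rnorm y <= C * g 0 y.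
Proof.
have [M HM] := A_bounded.
have C0 : 0 < Num.max 1 M by rewrite lt_max ltr01.
exists (Num.max 1 M) => // y; rewrite mulrC -ler_pdivrMr //; apply: le_kfun => x.
rewrite ler_pdivrMr // expr0 invr1 !mul1r mulrDl.
have -> : rnorm y = rnorm ((y - A x) + A x) by rewrite subrK.
apply: le_trans (rnormD _ _) _; rewrite lerD //.
  by rewrite ler_peMr ?rnorm_ge0 // le_max lexx.
apply: le_trans (HM x) _; rewrite mulrC ler_wpM2l ?rnorm_ge0 //.
by rewrite le_max lexx orbT.
Qed.

Definition ksup (N : nat) (y : Y) : R := sup [set g n y | n in [set n | (N <= n)%N]].

Section Vanish.
Variable y : Y.
Hypothesis yv : y \in kfun_vanish A.

Let has_sup_ksup N : has_sup [set g n y | n in [set n | (N <= n)%N]].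
Proof.
split; first by exists (g N y), N => /=.
move/asboolP: yv => /(_ 1 ltr01)[M HM].
exists (1 + 2 ^+ M * rnorm y) => _ [n _ <-].
have [Mn|nM] := leqP M n.
  by apply: le_trans (HM n Mn) _; rewrite lerDl mulr_ge0 ?rnorm_ge0 ?exprn_ge0.
apply: le_trans (kfun_le_norm _ _ _) _; rewrite -[leLHS]add0r lerD //.
by rewrite ler_wpM2r ?rnorm_ge0 // ler_eXn2l ?ltr1n // ltnW.
Qed.

Lemma kfun_ksup N n : (N <= n)%N -> g n y <= ksup N y.
Proof. by move=> Nn; apply: sup_upper_bound => //; exists n. Qed.

Lemma ksup_le N t : (forall n, (N <= n)%N -> g n y <= t) -> ksup N y <= t.
Proof.
move=> H; apply: ge_sup; first exact: (has_sup_ksup N).1.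
by move=> _ [n Nn <-]; exact: H.
Qed.

Lemma ksup_ge0 N : 0 <= ksup N y.
Proof. exact: le_trans (seminorm_ge0 (kfun_seminorm A N) y) (kfun_ksup (leqnn N)). Qed.

Lemma ksup_anti N M : (N <= M)%N -> ksup M y <= ksup N y.
Proof. by move=> NM; apply: ksup_le => n Mn; apply: kfun_ksup; exact: leq_trans Mn. Qed.

Lemma ksup_vanish e : 0 < e -> exists N, ksup N y <= e.
Proof. by move/asboolP: yv => H /H[N HN]; exists N; exact: ksup_le. Qed.

End Vanish.

(* The interpolation space depends on the proof of boundedness, which makes its
   seminorm a norm. *)
Record interp (h : bounded_map A) := Interp {
  interp_val : Y;
  interp_valP : interp_val \in kfun_vanish A
}.

End InterpolationSpace.

Section InterpolationSpaceNorm.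
Context {R : realType} {s : scalars R}.
Local Notation K := (scalar_field s).
Variables (X Y : completeNormedModType K) (A : {linear X -> Y}).
Variable A_bounded : bounded_map A.
Local Notation g := (kfun A).
Local Notation Z := (interp A_bounded).

HB.instance Definition _ := [isSub for @interp_val R s X Y A A_bounded].
HB.instance Definition _ := [Choice of Z by <:].
HB.instance Definition _ := [SubChoice_isSubLmodule of Z by <:].

Lemma interp_valZ (k : K) (z : Z) : interp_val (k *: z) = k *: interp_val z.
Proof. exact: (linearZ_LR (val : {linear Z -> Y})). Qed.

Lemma interp_valD (z z' : Z) : interp_val (z + z') = interp_val z + interp_val z'.
Proof. exact: (linearD (val : {linear Z -> Y})). Qed.

(** For [N = 0] this is the norm of Z. For larger [N] it bounds what a functional of the unit ball
    retains after [N] terms of its expansion. *)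
Definition interp_tail N (z : Z) : R := ksup A N (interp_val z).

Lemma interp_tail_seminorm N : seminorm (interp_tail N).
Proof.
have V (z : Z) : interp_val z \in kfun_vanish A by exact: interp_valP.
have ZZ (k : K) (z : Z) : interp_tail N (k *: z) <= rnorm (k : K^o) * interp_tail N z.
  rewrite /interp_tail; apply: ksup_le => // n Nn.
  rewrite interp_valZ (kfun_seminorm A n).2 ler_wpM2l ?(rnorm_ge0 (V := K^o)) //.
  exact: kfun_ksup.
split=> [u v|k v].
  rewrite /interp_tail; apply: ksup_le => // n Nn.
  rewrite interp_valD; apply: le_trans ((kfun_seminorm A n).1 _ _) _.
  by rewrite lerD //; exact: kfun_ksup.
apply/eqP; rewrite eq_le ZZ /=.
have [->|k0] := eqVneq k 0.
  by rewrite scale0r (rnorm0 (V := K^o)) mul0r; exact: ksup_ge0.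
have := ZZ k^-1 (k *: v); rewrite scalerA mulVf // scale1r.
have k1 : rnorm (k^-1 : K^o) * rnorm (k : K^o) = 1.
  by rewrite -(rnormM k^-1 k) /= mulVf // rnorm1.
move=> /(ler_wpM2l (rnorm_ge0 (k : K^o))); rewrite mulrA.
by rewrite [_ * rnorm (k^-1 : K^o)]mulrC k1 mul1r.
Qed.

Let norm (z : Z) : K := scalar_of (interp_tail 0 z).

Let ler_normD z z' : norm (z + z') <= norm z + norm z'.
Proof. by rewrite -scalar_ofD scalar_of_le; exact: (interp_tail_seminorm 0).1. Qed.

Let normrZ (k : K) z : norm (k *: z) = `|k| * norm z.
Proof.
by rewrite (rnormE (k : K^o)) -scalar_ofM; congr scalar_of; exact: (interp_tail_seminorm 0).2.
Qed.

Let normr0_eq0 z : norm z = 0 -> z = 0.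
Proof.
move=> nz; apply: val_inj => /=; apply/rnorm_eq0/eqP; rewrite eq_le rnorm_ge0 andbT.
have [C C0 HC] := kfun0_norm A_bounded.
apply: le_trans (HC _) _; rewrite pmulr_rle0 //.
suff -> : 0 = interp_tail 0 z by apply: kfun_ksup => //; exact: interp_valP.
by rewrite -[RHS](scalar_ofK (s := s)) [scalar_of _]nz -scalar_of0 scalar_ofK.
Qed.

HB.instance Definition _ := Lmodule_isNormed.Build K Z ler_normD normrZ normr0_eq0.

Lemma rnorm_interp (z : Z) : rnorm z = interp_tail 0 z.
Proof. by rewrite /rnorm [`|z|]/(scalar_of (interp_tail 0 z)) scalar_ofK. Qed.

Lemma kfun_rnorm (z : Z) n : g n (interp_val z) <= rnorm z.
Proof. by rewrite rnorm_interp; apply: kfun_ksup => //; exact: interp_valP. Qed.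

Lemma interp_val_bounded : bounded_map (@interp_val R s X Y A A_bounded).
Proof.
have [C C0 HC] := kfun0_norm A_bounded.
by exists C => z; apply: le_trans (HC _) _; rewrite ler_pM2l // kfun_rnorm.
Qed.

Let interp_complete (F : set_system Z) : ProperFilter F -> cauchy F -> cvg F.
Proof.
move=> PF /cauchyP cF.
have cF' e : 0 < e -> exists z : Z, F [set w | rnorm (w - z) < e].
  move=> e0; have [|z Fz] := cF (scalar_of e); first by rewrite -scalar_of0 scalar_of_lt.
  exists z; apply: filterS Fz => w; rewrite -ball_normE /= distrC rnormE.
  by rewrite scalar_of_lt.
have [C C0 HC] : exists2 C, 0 < C & forall z : Z, rnorm (interp_val z) <= C * rnorm z.
  have [C C0 HC] := kfun0_norm A_bounded.
  by exists C => // z; apply: le_trans (HC _) _; rewrite ler_pM2l // kfun_rnorm.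
have valB (z w : Z) : interp_val (z - w) = interp_val z - interp_val w.
  exact: (linearB (val : {linear Z -> Y})).
pose G : set_system Y := @interp_val R s X Y A A_bounded @ F.
have PG : ProperFilter G by exact: fmap_proper_filter.
have /cauchy_cvg cG : cauchy G.
  apply/cauchyP => e e0; have e'0 : 0 < scalar_Re e.
    by rewrite -(scalar_of_lt (s := s)) scalar_of0 scalar_ReK // ltW.
  have [|z Fz] := cF' (scalar_Re e / C); first by rewrite divr_gt0.
  exists (interp_val z); rewrite /G /=; apply: filterS Fz => w /= wz.
  rewrite -ball_normE /= distrC -valB rnormE -[ltRHS](scalar_ReK (ltW e0)) scalar_of_lt.
  by apply: le_lt_trans (HC _) _; rewrite mulrC -ltr_pdivlMr.
have /cvg_ex[y Gy] := cG.
(* A bound uniform in [n], which both puts the limit [y] into Z and gives convergence in its norm.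
   One [e] comes from a [w'] chosen after [n] so close to [y] in Y that the factor [2 ^+ n] does no
   harm; the other two come from [w] and [w'] lying in one ball around [z0]. *)
have close e : 0 < e -> exists z0 : Z, F [set w | rnorm (w - z0) < e] /\
    forall w, rnorm (w - z0) < e -> forall n, g n (y - interp_val w) <= e + (e + e).
  move=> e0; have [z0 Fz] := cF' e e0; exists z0; split=> // w wz n.
  have n0 : 0 < 2 ^+ n :> R by rewrite exprn_gt0.
  have Gv : F [set w | rnorm (interp_val w - y) < e / 2 ^+ n].
    apply: (Gy [set v | rnorm (v - y) < e / 2 ^+ n]).
    by apply/nbhs_rnorm; exists (e / 2 ^+ n) => //; rewrite divr_gt0.
  have [w' [/= wz' w'y]] := filter_ex (filterI Fz Gv).
  have -> : y - interp_val w = (y - interp_val w') + interp_val (w' - w).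
    by rewrite valB addrA subrK.
  apply: le_trans ((kfun_seminorm A n).1 _ _) _; rewrite lerD //.
    apply: le_trans (kfun_le_norm _ _ _) _; rewrite mulrC -ler_pdivlMr //.
    by rewrite rnormB ltW.
  apply: le_trans (kfun_rnorm _ _) _; apply: le_trans (rnorm_triangle z0 _ _) _.
  by rewrite lerD // ?(rnormB z0) ltW.
have yv : y \in kfun_vanish A.
  apply/asboolP => e e0; have [|z0 [Fz Hz]] := close (e / 6); first by rewrite divr_gt0.
  have [w /= wz] := filter_ex Fz.
  have /asboolP/(_ (e / 2))[|N HN] := interp_valP w; first by rewrite divr_gt0.
  exists N => n /HN Hn.
  have -> : y = (y - interp_val w) + interp_val w by rewrite subrK.
  apply: le_trans ((kfun_seminorm A n).1 _ _) _.
  by have := Hz w wz n; move: Hn; lra.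
pose z : Z := Interp A_bounded yv.
apply/cvg_ex; exists z => U /nbhs_rnorm[d d0 dU].
have [|z0 [Fz Hz]] := close (d / 6); first by rewrite divr_gt0.
apply: filterS Fz => w /= wz; apply: dU; rewrite rnormB rnorm_interp.
suff : interp_tail 0 (z - w) <= d / 2 by move=> H; apply: le_lt_trans H _; lra.
apply: ksup_le => [|n _]; first exact: interp_valP.
by rewrite valB /=; have := Hz w wz n; lra.
Qed.

HB.instance Definition _ := Uniform_isComplete.Build Z interp_complete.

End InterpolationSpaceNorm.

Definition interp_space (R : realType) (s : scalars R)
  (X Y : completeNormedModType (scalar_field s)) (A : {linear X -> Y})
  (A_bounded : bounded_map A) : completeNormedModType (scalar_field s) :=
  interp A_bounded.

(** * Lifting derivations along continuous maps of compact sets *)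

Section Lifting.
Context {P T : topologicalType}.
Variables (f : P -> T) (far far2 : T -> T -> Prop) (B : set P).
Hypothesis T_hausdorff : hausdorff_space T.
Hypothesis f_cont : forall u V, nbhs (f u) V -> nbhs u (f @^-1` V).
Hypothesis B_compact : compact B.
Hypothesis far_split : forall x y t, far x y -> far2 x t \/ far2 y t.

Let farf u v := far2 (f u) (f v).

Let cluster_iter a (F : set_system P) u : B u -> cluster F u ->
  F (deriv_iter farf a B) -> deriv_iter farf a B u.
Proof.
move=> Bu Fu Fa; apply: contrapT => nu.
have [V [Vu HV]] := deriv_iter_relclosed nu Bu.
by have [v [av /HV]] := Fu _ _ Fa (open_nbhs_nbhs Vu).
Qed.

Let cluster_fiber (F : set_system P) u t : cluster F u ->
  (forall V, nbhs t V -> F (f @^-1` V)) -> f u = t.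
Proof.
move=> Fu Ft; apply: T_hausdorff => U V /f_cont Uu /Ft FV.
by have [v [Vv Uv]] := Fu _ _ FV Uu; exists (f v).
Qed.

(** Near [t] there are far pairs of survivors, and one point of each pair is far from [t] itself in
    the weaker sense [far2]. Preimages of these points cluster, by compactness, at a point over [t],
    which is therefore far from points arbitrarily near it. Replacing [far] by [far2] is the price
    of the lifting. *)
Lemma deriv_iter_lift a t : deriv_iter far a (f @` B) t ->
  exists2 u, deriv_iter farf a B u & f u = t.
Proof.
elim: a t => [|a IH|J h c IH] t //=.
- move=> [_ Ht].
  (* Surviving parameters over [V] whose image is far from [t]. A cluster point [u] of these sets
     lies over [t], and [u] paired with members of [S] witnesses that it survives one more
     derivation. *)
  pose S V := [set u | [/\ deriv_iter farf a B u, V (f u) & far2 (f u) t]].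
  have PF : ProperFilter (filter_from (nbhs t) S).
    apply: filter_from_proper; first apply: filter_from_filter.
    - by exists setT; exact: filterT.
    - move=> V W Vt Wt; exists (V `&` W); first exact: filterI.
      by move=> u [au [Vu Wu] ut].
    - move=> V /Ht[x [y [Vx /IH[u au ux] Vy /IH[v av vy] /(far_split t)[xt|yt]]]].
        by exists u; split; rewrite ?ux.
      by exists v; split; rewrite ?vy.
  have [u [Bu Fu]] : B `&` cluster (filter_from (nbhs t) S) !=set0.
    apply: B_compact; exists setT; first exact: filterT.
    by move=> u [/deriv_iter_sub].
  have fu : f u = t.
    by apply: cluster_fiber Fu _ => V Vt; exists V => // v [].
  exists u => //; split.
    apply: cluster_iter Fu _ => //; exists setT; first exact: filterT.
    by move=> v [].
  move=> V Vu; have FT : filter_from (nbhs t) S (S setT).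
    by exists setT; first exact: filterT.
  have [v [[av _ vt] Vv]] := Fu _ _ FT Vu.
  exists v, u; split; rewrite /farf ?fu //; first exact: nbhs_singleton.
  apply: cluster_iter Fu _ => //; exists setT; first exact: filterT.
  by move=> w [].
- move=> Ht.
  (* The survivors in the fiber over [t] are nested in [i], so compactness gives one that survives
     all stages. *)
  pose S i := [set u | deriv_iter farf (c i) B u /\ f u = t].
  have PF : ProperFilter (filter_from setT S).
    apply: filter_from_proper; first apply: filter_from_filter.
    - by case: (h) => j; exists j.
    - move=> i j _ _; have [ij|ji] := ole_total (c i) (c j).
        exists j => // u [ju ut]; split; split=> //; exact: deriv_iter_anti ij _ ju.
      exists i => // u [iu ut]; split; split=> //; exact: deriv_iter_anti ji _ iu.
    - by move=> i _; have [u ? ?] := IH i t (Ht i I); exists u.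
  have [u [Bu Fu]] : B `&` cluster (filter_from setT S) !=set0.
    apply: B_compact; case: (h) => j; exists j => //.
    by move=> u [/deriv_iter_sub].
  exists u.
    move=> i _; apply: cluster_iter Fu _ => //.
    by exists i => // v [].
  apply: cluster_fiber Fu _ => V Vt; case: (h) => j; exists j => // v [_ vt].
  by rewrite /= vt; exact: nbhs_singleton.
Qed.

End Lifting.

(** * Szlenk derivations as derivations by the dual norm *)

Section DualNorm.
Context {R : realType} {s : scalars R}.
Local Notation K := (scalar_field s).
Context {X : normedModType K}.
Implicit Types (f g h : X -> K^o) (B : set (functionals X)).

Lemma dual_norm_le f (t : R) :
  (dual_norm f <= t%:E)%E <-> forall x, rnorm x <= 1 -> rnorm (f x) <= t.
Proof.
split=> [H x x1|H].
  by rewrite -lee_fin; apply: le_trans H; apply: ereal_sup_ubound; exists x.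
by apply: ge_ereal_sup => _ [x x1 <-]; rewrite lee_fin; exact: H.
Qed.

Lemma dual_norm_le_linear f (t : R) : linear f -> (dual_norm f <= t%:E)%E ->
  forall x, rnorm (f x) <= t * rnorm x.
Proof.
move=> linf /dual_norm_le H x.
have [x0|x0] := eqVneq (rnorm x) 0.
  by rewrite (rnorm_eq0 x0) (linear_pred0 linf) !rnorm0 mulr0.
have x1 : 0 < rnorm x by rewrite lt_def x0 rnorm_ge0.
have n1 : rnorm (scalar_of (rnorm x)^-1 : K^o) = (rnorm x)^-1.
  by rewrite rnorm_real ger0_norm // invr_ge0 rnorm_ge0.
have := H (scalar_of (rnorm x)^-1 *: x).
rewrite (linear_predZ linf) !rnormZ n1 mulVf // => /(_ (lexx _)).
by rewrite mulrC ler_pdivrMr.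
Qed.

Definition dual_far (e : R) (f g : functionals X) : Prop :=
  (e%:E < dual_norm ((f : X -> K^o) \- (g : X -> K^o))%R)%E.

Lemma dual_farN e (f g : functionals X) : ~ dual_far e f g <->
  forall x, rnorm x <= 1 -> rnorm (f x - g x : K^o) <= e.
Proof. by rewrite -dual_norm_le /dual_far; split=> [/negP|H]; [|apply/negP]; rewrite -leNgt. Qed.

Lemma dual_far_split e (f g h : functionals X) : dual_far (e + e) f g ->
  dual_far e f h \/ dual_far e g h.
Proof.
move=> fg; apply: contrapT => /not_orP[/dual_farN fh /dual_farN gh].
apply: (_ : ~ dual_far (e + e) f g) fg; apply/dual_farN => x x1.
apply: le_trans (rnorm_triangle (h x : K^o) _ _) _.
by rewrite lerD ?fh // rnormB gh.
Qed.

Lemma szlenk_derivE e B : szlenk_deriv e B = deriv (dual_far e) B.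
Proof.
apply/seteqP; split=> f [Bf H]; split=> // V /H.
  move/ereal_sup_gt => [_ [[u v] /= [[Vu Bu] [Vv Bv]] <-] uv].
  by exists u, v.
move=> [u [v [Vu Bu Vv Bv uv]]]; apply: lt_le_trans uv _.
by apply: ereal_sup_ubound; exists (u, v).
Qed.

Lemma szlenk_iterE e a B : szlenk_iter e a B = deriv_iter (dual_far e) a B.
Proof.
elim: a => [|a IH|J h c IH] //=; first by rewrite szlenk_derivE IH.
by apply: eq_bigcapr => i _; exact: IH.
Qed.

Lemma functionals_hausdorff : hausdorff_space (functionals X).
Proof. by apply: (@hausdorff_product X (fun=> K^o)) => _; exact: norm_hausdorff. Qed.

End DualNorm.

(** * Representation of the dual unit ball *)

Section PointwiseOperations.
Context {K : numFieldType} {V : normedModType K} {P : topologicalType}.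
Implicit Types (f h : P -> V).

Lemma continuous_addf f h : continuous f -> continuous h ->
  continuous (fun p => f p + h p).
Proof. by move=> cf ch p; apply: cvgD; [exact: cf|exact: ch]. Qed.

Lemma continuous_subf f h : continuous f -> continuous h ->
  continuous (fun p => f p - h p).
Proof. by move=> cf ch p; apply: cvgB; [exact: cf|exact: ch]. Qed.

Lemma continuous_scalef a f : continuous f -> continuous (fun p => a *: f p).
Proof. by move=> cf p; apply: cvgZr; exact: cf. Qed.

Lemma continuous_mulf (f h : P -> K^o) : continuous f -> continuous h ->
  continuous (fun p => f p * h p : K^o).
Proof. by move=> cf ch p; apply: cvgM; [exact: cf|exact: ch]. Qed.

Lemma continuous_normf f : continuous f -> continuous (fun p => `|f p| : K^o).
Proof. by move=> cf p; apply: cvg_norm; exact: cf. Qed.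

Lemma continuous_sumf N (F : nat -> P -> V) :
  (forall n, continuous (F n)) -> continuous (fun p => \sum_(n < N) F n p).
Proof.
move=> cF; elim: N => [|N IH].
  have -> : (fun p => \sum_(n < 0) F n p) = fun=> 0 by apply/funext => p; rewrite big_ord0.
  exact: cst_continuous.
have -> : (fun p => \sum_(n < N.+1) F n p) = fun p => \sum_(n < N) F n p + F N p.
  by apply/funext => p; rewrite big_ord_recr.
exact: continuous_addf.
Qed.

End PointwiseOperations.

Section Representation.
Context {R : realType} {s : scalars R}.
Local Notation K := (scalar_field s).
Variables (X Y : completeNormedModType K) (A : {linear X -> Y}).
Variable A_bounded : bounded_map A.
Local Notation g := (kfun A).
Local Notation Z := (interp_space A_bounded).
Local Notation zval := (@interp_val R s X Y A A_bounded).
Local Notation tail := (@interp_tail R s X Y A A_bounded).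

(* A point [p] encodes a sequence of weights [coeff p n], a sequence of
   functionals [func p n] on [Y] and a functional [rest p] on [Z]. *)
Definition param : eqType := ((nat + nat * Y) + Z)%type.
Definition params := {ptws param -> K^o}.
Implicit Types p q : params.

Definition coeff p n : K^o := p (inl (inl n)).
Definition func p n (y : Y) : K^o := p (inl (inr (n, y))).
Definition rest p (z : Z) : K^o := p (inr z).

(** [Q] lists the [N] at which the remainder is controlled: an initial segment for truncated
    expansions, [setT] for full ones. The bound by [tail N z] stands in for the equation
    [rest p = sum_n coeff p n * func p n], because it survives pointwise limits of truncations. *)
Definition admissible (Q : set nat) (r : R) : set params :=
  [set p | [/\ forall N, \sum_(n < N) rnorm (coeff p n) <= r,
     forall n, linear (func p n),
     forall n y, rnorm (func p n y) <= g n y &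
     forall N z, Q N ->
       rnorm (rest p z - \sum_(n < N) coeff p n * func p n (zval z) : K^o) <= tail N z]].

Lemma param_continuous (i : param) : continuous (fun p : params => p i : K^o).
Proof. exact: (@proj_continuous param (fun=> K^o : topologicalType) i). Qed.

Lemma closure_rnorm_le (S : set params) (f : params -> K^o) t p :
  continuous f -> (forall q, S q -> rnorm (f q) <= t) -> closure S p ->
  rnorm (f p) <= t.
Proof.
move=> cf Sf Sp; apply/ler_addgt0Pr => e e0.
have [q [Sq /= fq]] : S `&` (f @^-1` [set k : K^o | rnorm (k - f p) < e]) !=set0.
  by apply: Sp; apply: cf; apply/nbhs_rnorm; exists e.
have -> : f p = f q + (f p - f q) by rewrite addrC subrK.
by apply: le_trans (rnormD _ _) _; rewrite lerD ?Sf // rnormB ltW.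
Qed.

Lemma coeff_continuous n : continuous (fun p => coeff p n).
Proof. exact: param_continuous. Qed.

Lemma func_continuous n y : continuous (fun p => func p n y).
Proof. exact: param_continuous. Qed.

Lemma rest_continuous z : continuous (fun p => rest p z).
Proof. exact: param_continuous. Qed.

Lemma admissible_closed Q r : closed (admissible Q r).
Proof.
move=> p clp; split=> [N|n a u v|n y|N z QN].
(* The mass of a head is rewritten as the norm of one scalar-valued continuous function, the form
   required by [closure_rnorm_le]. *)
- have sumE q : rnorm (\sum_(n < N) `|coeff q n| : K^o) = \sum_(n < N) rnorm (coeff q n).
    rewrite -[RHS](scalar_ofK (s := s)) /rnorm ger0_norm; last exact: sumr_ge0.
    congr scalar_Re; rewrite (big_morph _ scalar_ofD scalar_of0).
    by apply: eq_bigr => i _; exact: rnormE.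
  rewrite -sumE.
  apply: (@closure_rnorm_le _ (fun q => \sum_(n < N) `|coeff q n| : K^o) _ _ _ _ clp)
    => [|q [Sq _ _ _]].
    apply: (continuous_sumf (F := fun n q => `|coeff q n| : K^o)) => n.
    exact: (continuous_normf (@coeff_continuous n)).
  by rewrite sumE.
- apply/eqP; rewrite -subr_eq0; apply/eqP/(rnorm_eq0 (V := K^o))/eqP.
  rewrite eq_le (rnorm_ge0 (V := K^o)) andbT.
  apply: (@closure_rnorm_le _
    (fun q => func q n (a *: u + v) - (a *: func q n u + func q n v)) _ _ _ _ clp).
    apply: continuous_subf; first exact: func_continuous.
    apply: continuous_addf; last exact: func_continuous.
    exact: (continuous_scalef (@func_continuous n u)).
  by move=> q [_ Hl _ _]; rewrite Hl subrr rnorm0.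
- apply: (@closure_rnorm_le _ (fun q => func q n y) _ _ _ _ clp).
    exact: func_continuous.
  by move=> q [_ _ H _]; exact: H.
- apply: (@closure_rnorm_le _
    (fun q => rest q z - \sum_(n < N) coeff q n * func q n (zval z)) _ _ _ _ clp).
    apply: continuous_subf; first exact: rest_continuous.
    apply: (continuous_sumf (F := fun n q => coeff q n * func q n (zval z))) => n.
    exact: (continuous_mulf (@coeff_continuous n) (@func_continuous n (zval z))).
  by move=> q [_ _ _ H]; exact: H.
Qed.

(** Every coordinate is bounded: weights by [r], functionals by [g n y], and [rest p z] by
    [tail 0 z], which is the remainder condition for the empty sum. *)
Lemma admissible_compact Q r : Q 0%N -> compact (admissible Q r).
Proof.
move=> Q0; apply: (@ptws_subcompact R s param (fun i => match i with
  | inl (inl n) => r | inl (inr (n, y)) => g n y | inr z => tail 0 z end)).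
  exact: admissible_closed.
move=> p [[n|[n y]]|z] [Hc Hl Hf Hr].
- have := Hc n.+1; rewrite big_ord_recr /=; apply: le_trans.
  by rewrite lerDr sumr_ge0 // => i _; exact: rnorm_ge0.
- exact: Hf.
- by have := Hr 0%N z Q0; rewrite big_ord0 subr0.
Qed.

(** Cut the expansion again at a large [M]. Beyond [M] the remainder is at most [tail M z], which is
    as small as desired since [z] lies in Z; the terms from [N] to [M] cost at most the mass left
    after [N], as [g n] is bounded by the norm of [z]. *)
Lemma rest_tail r p N z : admissible setT r p ->
  rnorm (rest p z - \sum_(n < N) coeff p n * func p n (zval z) : K^o) <=
    (r - \sum_(n < N) rnorm (coeff p n)) * rnorm z.
Proof.
move=> [Hc Hl Hf Hr]; apply/ler_addgt0Pr => e e0.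
have [M0 HM0] := ksup_vanish (interp_valP z) e0.
pose M := maxn N M0.
have NM : (N <= M)%N by exact: leq_maxl.
have tM : tail M z <= e.
  apply: le_trans HM0; apply: ksup_anti (leq_maxr _ _); exact: interp_valP.
have HE (V : zmodType) (F : nat -> V) :
    \sum_(n < M) F n = \sum_(n < N) F n + \sum_(N <= n < M) F n.
  by rewrite -!(big_mkord xpredT) -big_cat_nat.
have := Hr M z I.
rewrite (HE _ (fun n => coeff p n * func p n (zval z))) opprD addrA => H1.
have H2 : rnorm (\sum_(N <= n < M) coeff p n * func p n (zval z) : K^o) <=
    (\sum_(N <= n < M) rnorm (coeff p n)) * rnorm z.
  rewrite mulr_suml; elim/big_ind2: _ => [|x a y b xa yb|n _].
  - by rewrite (rnorm0 (V := K^o)).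
  - by apply: le_trans (rnormD _ _) _; rewrite lerD.
  - rewrite (rnormM (coeff p n)) ler_wpM2l ?rnorm_ge0 //.
    by apply: le_trans (Hf _ _) _; exact: kfun_rnorm.
have := Hc M; rewrite (HE _ (fun n => rnorm (coeff p n))) => H3.
set x := rest p z - _ in H1 *; set y := \sum_(N <= n < M) _ in H1 H2.
have -> : x = (x - y) + y by rewrite subrK.
apply: le_trans (rnormD _ _) _; rewrite addrC lerD //; last exact: le_trans H1 tM.
apply: le_trans H2 _; rewrite ler_wpM2r ?rnorm_ge0 //; lra.
Qed.

(** Surjectivity of the parametrization. The norm of Z is the maximum of finitely many [g i] and a
    tail, so [f] splits accordingly; Hahn-Banach extends the pieces from Z to Y, and a cluster point
    of these truncated expansions is a full one. *)
Lemma dual_ball_rest f : dual_ball Z f -> exists2 p, admissible setT 1 p & rest p = f.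
Proof.
move=> [[linf _] f1].
have fz z : rnorm (f z : K^o) <= rnorm z.
  by have := dual_norm_le_linear linf f1 z; rewrite mul1r.
have step M : exists2 p, admissible [set N | (N <= M)%N] 1 p & rest p = f.
  (* The last of the [M.+1] seminorms collects all [g n] with [n >= M]. Its share of [f] gets no
     weight in [c'] and only enters the remainder. *)
  pose h (i : 'I_M.+1) (z : Z) := if (i < M)%N then g i (zval z) else tail M z.
  have zD (u v : Z) : zval (u + v) = zval u + zval v by exact: interp_valD.
  have zZ (k : K) (v : Z) : zval (k *: v) = k *: zval v by exact: interp_valZ.
  have hh i : seminorm (h i).
    have [iM|iM] := boolP (i < M)%N; last first.
      have -> : h i = tail M by apply/funext => z; rewrite /h (negbTE iM).
      exact: interp_tail_seminorm.
    have -> : h i = g i \o zval by apply/funext => z; rewrite /h iM.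
    split=> [u v|k v].
      by have := (kfun_seminorm A i).1 (zval u) (zval v); rewrite -zD.
    by have := (kfun_seminorm A i).2 k (zval v); rewrite -zZ.
  have hle (i : 'I_M.+1) N z : (N <= i)%N -> h i z <= tail N z.
    move=> Ni; rewrite /h; case: ltnP => [iM|Mi].
      by apply: kfun_ksup => //; exact: interp_valP.
    apply: ksup_anti; first exact: interp_valP.
    by apply: leq_trans Ni _; rewrite -ltnS.
  have [|c [F [c0 c1 linF Fh fF]]] := dual_max_decomposition hh linf.
    move=> z t t0 ht; apply: le_trans (fz z) _; rewrite rnorm_interp.
    apply: ksup_le => [|n _]; first exact: interp_valP.
    have [nM|Mn] := ltnP n M.
      have nM1 : (n < M.+1)%N by exact: ltnW.
      by have := ht (Ordinal nM1); rewrite /h /= nM.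
    have := ht ord_max; rewrite /h /= ltnn; apply: le_trans.
    by apply: kfun_ksup => //; exact: interp_valP.
  pose c' n : R := if (n < M)%N then c (inord n) else 0.
  have c'0 n : 0 <= c' n by rewrite /c'; case: ifP.
  have HG n : exists G : Y -> K^o, [/\ linear G, forall y, rnorm (G y) <= g n y &
      forall z, (n < M)%N -> scalar_of (c' n) * G (zval z) = F (inord n) z].
    have [nM|Mn] := ltnP n M; last first.
      exists (fun=> 0); split=> [a u v|y|//]; first by rewrite scaler0 addr0.
      by rewrite rnorm0 (seminorm_ge0 (kfun_seminorm A n)).
    have in_ : nat_of_ord (inord n : 'I_M.+1) = n by rewrite inordK // ltnW.
    pose val' : {linear Z -> Y} := val.
    have [||G [linG Gg GF]] := @hahn_banach_seminorm R s Y Z val'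
        (fun y => c' n * g n y) (F (inord n)) _ (linF (inord n)).
    - exact: seminormZl (kfun_seminorm A n).
    - by move=> z; have := Fh (inord n) z; rewrite /h in_ nM /c' nM.
    (* With weight zero no normalization is possible, but then the piece [F (inord n)] vanishes and
       the zero functional will do. *)
    have [cn|cn] := eqVneq (c' n) 0.
      exists (fun=> 0); split=> [a u v|y|z _]; first by rewrite scaler0 addr0.
        by rewrite rnorm0 (seminorm_ge0 (kfun_seminorm A n)).
      rewrite mulr0; apply/esym/(rnorm_eq0 (V := K^o))/eqP.
      rewrite eq_le rnorm_ge0 andbT; have := Gg (zval z).
      by rewrite cn mul0r -[zval z]/(val' z) GF.
    have cn0 : 0 < c' n by rewrite lt_def cn c'0.
    exists (fun y => scalar_of (c' n)^-1 * G y); split=> [a u v|y|z _].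
    + by rewrite linG mulrDr; congr (_ + _); rewrite /GRing.scale /= mulrCA.
    + rewrite (rnormM (scalar_of _)) rnorm_real ger0_norm ?invr_ge0 //.
      by rewrite mulrC ler_pdivrMr // mulrC.
    + rewrite mulrA -scalar_ofM mulfV // scalar_of1 mul1r.
      by rewrite -[zval z]/(val' z) GF.
  have [G HGG] := choice HG.
  exists (fun i => match i with
    | inl (inl n) => scalar_of (c' n) | inl (inr (n, y)) => G n y | inr z => f z end) => //.
  split=> [N|n|n y|N z /= NM]; rewrite /coeff /func /rest.
  - have -> : \sum_(n < N) rnorm (scalar_of (c' n) : K^o) = \sum_(n < N) c' n.
      by apply: eq_bigr => i _; rewrite rnorm_real ger0_norm.
    apply: le_trans c1.
    have -> : \sum_i c i = \sum_(0 <= n < M.+1) c (inord n).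
      by rewrite big_mkord; apply: eq_bigr => i _; rewrite inord_val.
    rewrite -(big_mkord xpredT).
    apply: (@le_trans _ _ (\sum_(0 <= n < maxn N M.+1) c' n)).
      rewrite (@big_cat_nat _ _ _ N 0 (maxn N M.+1)) ?leq_maxl //= lerDl.
      by rewrite sumr_ge0.
    rewrite (@big_cat_nat _ _ _ M.+1 0 (maxn N M.+1)) ?leq_maxr //=.
    have -> : \sum_(M.+1 <= n < maxn N M.+1) c' n = 0.
      by rewrite big_nat_cond big1 // => i /andP[/andP[Mi _] _]; rewrite /c' ltnNge (ltnW Mi).
    by rewrite addr0; apply: ler_sum => i _; rewrite /c'; case: ifP.
  - by case: (HGG n).
  - by case: (HGG n) => _ + _; exact.
  (* The remainder consists of the pieces from [N] up to and including the tail piece [M]. Each is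
     bounded by its weight times [tail N z], and the weights sum to at most 1. *)
  - have -> : f z - \sum_(n < N) scalar_of (c' n) * G n (zval z) =
        \sum_(N <= n < M.+1) F (inord n) z.
      rewrite fF; have -> : \sum_i F i z = \sum_(0 <= n < M.+1) F (inord n) z.
        by rewrite big_mkord; apply: eq_bigr => i _; rewrite inord_val.
      rewrite (@big_cat_nat _ _ _ N 0 M.+1) //= ?leqW // big_mkord.
      rewrite [X in X + _ - _](_ : _ = \sum_(n < N) scalar_of (c' n) * G n (zval z)).
        by rewrite addrAC subrr add0r.
      apply: eq_bigr => i _; case: (HGG i) => _ _ -> //.
      exact: leq_trans (ltn_ord i) NM.
    apply: (@le_trans _ _ (\sum_(N <= n < M.+1) c (inord n) * tail N z)).
      rewrite big_nat_cond [leRHS]big_nat_cond; elim/big_ind2: _ => [|x a y b xa yb|n].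
      - by rewrite (rnorm0 (V := K^o)).
      - by apply: le_trans (rnormD _ _) _; rewrite lerD.
      - move=> /andP[/andP[Nn nM] _]; apply: le_trans (Fh _ _) _.
        by rewrite ler_wpM2l // hle // inordK.
    rewrite -mulr_suml ler_piMl //; first by apply: ksup_ge0; exact: interp_valP.
    apply: le_trans c1.
    have -> : \sum_i c i = \sum_(0 <= n < M.+1) c (inord n).
      by rewrite big_mkord; apply: eq_bigr => i _; rewrite inord_val.
    by rewrite (@big_cat_nat _ _ _ N 0 M.+1) //= ?leqW // lerDr sumr_ge0.
(* Later truncations satisfy more of the remainder conditions, and all have the same [rest]. A
   cluster point inherits every closed condition that eventually holds. *)
pose S M := [set p | admissible [set N | (N <= M)%N] 1 p /\ rest p = f].
have PF : ProperFilter (filter_from setT S).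
  apply: filter_from_proper; last by move=> M _; have [p ? ?] := step M; exists p.
  apply: filter_from_filter; first by exists 0%N.
  move=> M M' _ _; exists (maxn M M') => // p [[? ? ? H] pf].
  by split; (split=> //; split=> // N z /= NM; apply: H => /=;
    rewrite leq_max NM ?orbT).
have [p [_ Fp]] : admissible [set N | (N <= 0)%N] 1 `&` cluster (filter_from setT S)
    !=set0.
  by apply: admissible_compact => //; exists 0%N => // p [].
have clS M : closure (S M) p by move=> U pU; apply: Fp => //; exists M.
exists p.
  have adm M : admissible [set N | (N <= M)%N] 1 p.
    by apply: admissible_closed => U pU; have [q [[? _] ?]] := clS M U pU; exists q.
  by split=> [N|n|n y|N z _]; [case: (adm 0%N)|case: (adm 0%N)|case: (adm 0%N)|
    case: (adm N) => _ _ _; apply => /=].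
apply/funext => z; apply/eqP; rewrite -subr_eq0; apply/eqP/(rnorm_eq0 (V := K^o))/eqP.
rewrite eq_le rnorm_ge0 andbT.
apply: (@closure_rnorm_le _ (fun q => rest q z - f z) _ _ _ _ (clS 0%N)).
  by apply: continuous_subf; [exact: rest_continuous|exact: cst_continuous].
by move=> q [_ ->]; rewrite subrr rnorm0.
Qed.

End Representation.

(** * Derivations lower the mass *)

Section Estimate.
Context {R : realType} {s : scalars R}.
Local Notation K := (scalar_field s).
Variables (X Y : completeNormedModType K) (A : {linear X -> Y}).
Variable A_bounded : bounded_map A.
Local Notation g := (kfun A).
Local Notation Z := (interp_space A_bounded).
Local Notation zval := (@interp_val R s X Y A A_bounded).
Local Notation params := (params A_bounded).
Local Notation admissible := (@admissible R s X Y A A_bounded setT).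
Local Notation coeff := (@coeff R s X Y A A_bounded).
Local Notation func := (@func R s X Y A A_bounded).
Local Notation rest := (@rest R s X Y A A_bounded).
Implicit Types p q u v : params.

Local Notation dual_image :=
  [set ((h : Y -> K^o) \o A : functionals X) | h in dual_ball Y].

(** This is [2^-n A^* y_n]. As [y_n] is dominated by [g n], hence by [2^n] times the norm of Y, the
    factor brings it into the image of the dual ball of Y under [A^*], where the hypothesis on [A]
    applies. *)
Definition scaled_func n p : functionals X :=
  fun x => scalar_of (2 ^- n) * func p n (A x).

Lemma rnorm_exp2V n : rnorm (scalar_of (2 ^- n) : K^o) = 2 ^- n :> R.
Proof. by rewrite rnorm_real ger0_norm // invr_ge0 exprn_ge0. Qed.

Lemma scaled_func_dual_image r p n : admissible r p -> dual_image (scaled_func n p).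
Proof.
move=> [_ linf fg _].
have le1 y : rnorm (scalar_of (2 ^- n) * func p n y : K^o) <= rnorm y.
  rewrite (rnormM (scalar_of _)) rnorm_exp2V mulrC ler_pdivrMr ?exprn_gt0 //.
  by rewrite mulrC; apply: le_trans (fg _ _) (kfun_le_norm _ _ _).
exists ((fun y => scalar_of (2 ^- n) * func p n y) : functionals Y) => //.
split; last by apply/dual_norm_le => y; apply: le_trans.
split; last by exists 1 => y; rewrite mul1r.
by move=> a y y'; rewrite linf mulrDr; congr (_ + _); rewrite /GRing.scale /= mulrCA.
Qed.

Lemma scaled_func_continuous n p V : nbhs (scaled_func n p) V ->
  nbhs p (scaled_func n @^-1` V).
Proof.
apply: (@nbhs_ptws_map R s X (param A_bounded) (fun x q => scaled_func n q x)).
move=> x d d0; apply: filterS (nbhs_ptws_coord p (inl (inr (n, A x))) d0) => q.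
rewrite /= /scaled_func -mulrBr (rnormM (scalar_of _)) rnorm_exp2V; apply: le_lt_trans.
rewrite mulrC ler_piMr ?rnorm_ge0 // invf_le1 ?exprn_gt0 //.
by rewrite -natrX ler1n expn_gt0.
Qed.

Lemma rest_nbhs p V : nbhs (rest p : functionals Z) V ->
  nbhs p [set q | V (rest q)].
Proof.
apply: (@nbhs_ptws_map R s Z (param A_bounded) (fun z q => rest q z)).
by move=> z d d0; exact: (nbhs_ptws_coord p (inr z) d0).
Qed.

Lemma exp2_unbounded (t : R) : exists m, t <= 2 ^+ m.
Proof.
exists (Num.bound `|t|); apply: le_trans (ler_norm t) _.
apply: le_trans (ltW (archi_boundP (normr_ge0 t))) _.
by rewrite -natrX ler_nat ltnW // ltn_expl.
Qed.

(* Real interpolation: [z] splits into a part that is small in [Y] and the image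
   under [A] of a part that is bounded in [X]. *)
Lemma func_dual_close N (eta : R) : 0 < eta -> exists2 kappa : R, 0 < kappa &
  forall r u v n, (n < N)%N -> admissible r u -> admissible r v ->
    ~ dual_far kappa (scaled_func n u) (scaled_func n v) ->
    forall z : Z, rnorm z <= 1 -> rnorm (func u n (zval z) - func v n (zval z) : K^o) <= eta.
Proof.
(* Each part of [z] is to contribute [eta / 2]. The part in Y has norm at most [2 / 2^m] and meets a
   functional of norm at most [2 * 2^N], which dictates [m]; the part from X has norm at most
   [2 * 2^m] and meets one of norm at most [2^N * kappa], which dictates [kappa]. *)
move=> eta0; have [m Hm] := exp2_unbounded (2 ^+ N.+3 / eta).
have m0 : 0 < 2 ^+ m :> R by rewrite exprn_gt0.
have N0 : 0 < 2 ^+ N :> R by rewrite exprn_gt0.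
exists (eta / (2 ^+ N.+2 * 2 ^+ m)); first by rewrite divr_gt0 // mulr_gt0 // exprn_gt0.
set kappa := eta / _ => r u v n nN [_ linu ug _] [_ linv vg _] uv z z1.
have k0 : 0 <= kappa.
  by apply: divr_ge0; [exact: ltW|apply: mulr_ge0; exact: exprn_ge0].
have n0 : 0 < 2 ^+ n :> R by rewrite exprn_gt0.
have nN' : 2 ^+ n <= 2 ^+ N :> R by rewrite ler_eXn2l ?ltr1n // ltnW.
pose h y : K^o := func u n y - func v n y.
have linh : linear h.
  by move=> a y y'; rewrite /h linu linv scalerBr opprD addrACA.
have hA x : rnorm (h (A x)) <= 2 ^+ n * kappa * rnorm x.
  have linhA : linear ((fun x => scalar_of (2 ^- n) * h (A x)) : X -> K^o).
    move=> a y y'; rewrite linearP linh mulrDr; congr (_ + _).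
    by rewrite /GRing.scale /= mulrCA.
  have := dual_norm_le_linear (t := kappa) linhA; have [] := dual_norm_le
    (fun x => scalar_of (2 ^- n) * h (A x) : K^o) kappa.
  move=> _ -> => [/(_ isT x)|y y1].
    rewrite (rnormM (scalar_of _)) rnorm_exp2V mulrC ler_pdivrMr //.
    by rewrite -mulrA mulrC mulrA.
  by move/dual_farN/(_ y y1) : uv; rewrite /scaled_func -mulrBr.
have hY y : rnorm (h y) <= 2 * 2 ^+ n * rnorm y.
  apply: le_trans (rnormD _ _) _; rewrite rnormN -mulrA mulr2n mulrDl mul1r.
  by rewrite lerD //; [apply: le_trans (ug _ _) _|apply: le_trans (vg _ _) _];
    exact: kfun_le_norm.
(* The infimum [g m z] is at most 1 but may not be attained, hence the strict bound 2. *)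
have [x Hx] : exists x, 2 ^+ m * rnorm (zval z - A x) + 2 ^- m * rnorm x < 2.
  apply: kfun_lt; apply: le_lt_trans (kfun_rnorm z m) _.
  by apply: le_lt_trans z1 _; rewrite ltr1n.
have y2 : rnorm (zval z - A x) <= 2 / 2 ^+ m.
  rewrite ler_pdivlMr // mulrC; apply: le_trans (ltW Hx).
  by rewrite lerDl mulr_ge0 ?rnorm_ge0 // invr_ge0 ltW.
have x2 : rnorm x <= 2 * 2 ^+ m.
  rewrite -ler_pdivrMr // mulrC; apply: le_trans (ltW Hx).
  by rewrite lerDr mulr_ge0 ?rnorm_ge0 // ltW.
have -> : func u n (zval z) - func v n (zval z) = h (zval z - A x) + h (A x).
  by rewrite (linear_predB linh) subrK.
apply: le_trans (rnormD _ _) _; rewrite [eta]splitr lerD //.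
  apply: le_trans (hY _) _.
  apply: (@le_trans _ _ (2 * 2 ^+ N * (2 / 2 ^+ m))).
    by apply: ler_pM; rewrite ?mulr_ge0 ?rnorm_ge0 ?(ltW n0) ?ler_wpM2l.
  rewrite mulrA ler_pdivrMr // -ler_pdivrMl ?divr_gt0 //.
  apply: le_trans Hm; rewrite invf_div !exprS le_eqVlt; apply/predU1P; left; field.
  by rewrite gt_eqF.
apply: le_trans (hA _) _.
apply: (@le_trans _ _ (2 ^+ N * kappa * (2 * 2 ^+ m))).
  apply: ler_pM => //; first by apply: mulr_ge0 => //; exact: ltW.
    exact: rnorm_ge0.
  exact: ler_wpM2r.
rewrite /kappa !exprS le_eqVlt; apply/predU1P; left; field.
by rewrite !gt_eqF.
Qed.

Lemma sum_rnorm_le N (F : nat -> K^o) (G : nat -> R) :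
  (forall n, (n < N)%N -> rnorm (F n) <= G n) ->
  rnorm (\sum_(n < N) F n : K^o) <= \sum_(n < N) G n.
Proof.
elim: N => [|N IH] H; first by rewrite !big_ord0 rnorm0.
rewrite !big_ord_recr /=; apply: le_trans (rnormD _ _) _.
by rewrite lerD ?H // IH // => n nN; apply: H; exact: ltnW.
Qed.

(* Once the weights of the heads nearly exhaust the mass [r], the tails are
   small, so that derivations only see finitely many functionals. *)
Lemma admissible_deriv xi r (eta : R) : r <= 1 -> 0 < eta ->
  (forall e, 0 < e -> deriv_iter (dual_far e) (omega_pow xi) dual_image = set0) ->
  deriv_iter (fun u v => dual_far (5 * eta) (rest u : functionals Z) (rest v))
    (omega_pow xi) (admissible r) `<=` admissible (r - eta).
Proof.
move=> r1 eta0 A0 p Hp.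
have admp : admissible r p by exact: deriv_iter_sub Hp.
(* The product argument needs at least one coordinate; the bound for [N] follows from the one for
   [N.+1]. *)
suff H N : (0 < N)%N -> \sum_(n < N) rnorm (coeff p n) <= r - eta.
  case: admp => cr ? ? ?; split=> // N; have := H N.+1 isT.
  by rewrite big_ord_recr /=; apply: le_trans; rewrite lerDl rnorm_ge0.
move=> N0; rewrite leNgt; apply/negP => big.
have [kappa kappa0 Hk] := func_dual_close N eta0.
(* When each of the [N] head weights moves by less than [d], the total change is at most [eta], and
   also at most the excess of the head mass of [p] over [r - eta]. Hence all heads near [p] still
   carry mass [r - eta]. *)
pose d := Num.min eta (\sum_(n < N) rnorm (coeff p n) - (r - eta)) / N%:R.
have N0' : 0 < N%:R :> R by rewrite ltr0n.
have mn0 : 0 < Num.min eta (\sum_(n < N) rnorm (coeff p n) - (r - eta)).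
  by rewrite lt_min eta0 subr_gt0.
have d0 : 0 < d by rewrite divr_gt0.
have Nd : N%:R * d = Num.min eta (\sum_(n < N) rnorm (coeff p n) - (r - eta)).
  by rewrite /d mulrC divfK // gt_eqF.
have Nd1 : N%:R * d <= eta by rewrite Nd ge_min lexx.
have Nd2 : N%:R * d <= \sum_(n < N) rnorm (coeff p n) - (r - eta).
  by rewrite Nd ge_min lexx orbT.
pose l : seq (param A_bounded) := [seq inl (inl n) | n <- iota 0 N].
have := nbhs_ptws_coords p l d0; rewrite nbhsE => -[U [oU Up] UH].
have close q n : U q -> (n < N)%N -> rnorm (coeff q n - coeff p n : K^o) < d.
  move=> /UH/(_ (inl (inl n))) H nN; apply: H; apply/mapP; exists n => //.
  by rewrite mem_iota.
have sumd : \sum_(n < N) d = N%:R * d by rewrite sumr_const card_ord mulr_natl.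
have heavy q : U q -> r - eta <= \sum_(n < N) rnorm (coeff q n).
  move=> Uq; have : \sum_(n < N) rnorm (coeff p n) <= \sum_(n < N) (rnorm (coeff q n) + d).
    apply: ler_sum => n _; rewrite -lerBlDl; apply: le_trans (ltW (close q n Uq (ltn_ord n))).
    rewrite rnormB lerBlDr; apply: le_trans (rnormD _ _).
    by rewrite subrK.
  by rewrite big_split /= sumd; lra.
have cont n x V : (n < N)%N -> nbhs (scaled_func n x) V -> nbhs x (scaled_func n @^-1` V).
  by move=> _; exact: scaled_func_continuous.
have := deriv_iter_localize oU (conj Hp Up).
(* Some coordinate [scaled_func n] of [p] would survive [omega_pow xi] derivations of the image of
   the dual ball, against [A0]. What has to be shown is that points of [U] that are far in Z^* have
   a far pair among their first [N] functionals. *)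
move=> /(deriv_iter_box N0 cont (far := dual_far kappa) (E := fun=> dual_image)).
case=> [u n [admu _] _|u v [admu Uu] [admv Uv] uv|n nN].
- exact: scaled_func_dual_image admu.
- apply: contrapT => nfar; apply: (_ : ~ dual_far (5 * eta) _ _) uv.
  apply/dual_farN => z z1.
  have Hn n : (n < N)%N -> rnorm (func u n (zval z) - func v n (zval z) : K^o) <= eta.
    move=> nN; apply: (Hk r u v n nN admu admv _ z z1) => far.
    by apply: nfar; exists n.
  pose su : K^o := \sum_(n < N) coeff u n * func u n (zval z).
  pose sv : K^o := \sum_(n < N) coeff v n * func v n (zval z).
  have tails q : admissible r q -> U q ->
      rnorm (rest q z - \sum_(n < N) coeff q n * func q n (zval z) : K^o) <= eta.
    move=> admq Uq; apply: le_trans (rest_tail N z admq) _.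
    have H1 : r - \sum_(n < N) rnorm (coeff q n) <= eta by have := heavy q Uq; lra.
    have H2 : 0 <= r - \sum_(n < N) rnorm (coeff q n).
      by rewrite subr_ge0; case: admq => ->.
    by rewrite -[eta]mulr1 ler_pM ?rnorm_ge0.
  (* The change of a weight is paid by [d + d] through [p], since the functionals are at most 1 at
     [z]; the change of a functional is paid by [eta] times its weight. Summed, this is at most
     [3 eta] because [r <= 1], and the two tails bring it to [5 eta]. *)
  have mid : rnorm (su - sv) <= \sum_(n < N) (d + d + rnorm (coeff v n) * eta).
    rewrite /su /sv -sumrB.
    apply: (@sum_rnorm_le N (fun n => coeff u n * func u n (zval z) -
       coeff v n * func v n (zval z)) (fun n => d + d + rnorm (coeff v n) * eta)) => n nN.
    have -> : coeff u n * func u n (zval z) - coeff v n * func v n (zval z) =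
        (coeff u n - coeff v n) * func u n (zval z) +
        coeff v n * (func u n (zval z) - func v n (zval z)) by ring.
    apply: le_trans (rnormD _ _) _; rewrite !rnormM lerD //; last first.
      by rewrite ler_wpM2l ?rnorm_ge0 // Hn.
    have f1 : rnorm (func u n (zval z)) <= 1.
      case: admu => _ _ /(_ n (zval z)) H _.
      exact: le_trans H (le_trans (kfun_rnorm z n) z1).
    rewrite -[d + d]mulr1 ler_pM ?rnorm_ge0 //.
    apply: le_trans (rnorm_triangle (coeff p n) _ _) _.
    by rewrite lerD ?(ltW (close _ _ _ _)) // rnormB (ltW (close _ _ _ _)).
  have {mid} : rnorm (su - sv) <= eta + eta + eta.
    apply: le_trans mid _; rewrite !big_split /= sumd -mulr_suml.
    have : (\sum_(n < N) rnorm (coeff v n)) * eta <= eta.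
      rewrite ler_piMl ?(ltW eta0) //; case: admv => /(_ N) H _ _ _; exact: le_trans H r1.
    lra.
  have := tails u admu Uu; have := tails v admv Uv; rewrite -/su -/sv => H1 H2 H3.
  have -> : rest u z - rest v z = (rest u z - su) + ((su - sv) - (rest v z - sv)).
    by ring.
  apply: le_trans (rnormD _ _) _; have := rnormD (su - sv) (- (rest v z - sv)).
  rewrite rnormN; lra.
- by rewrite A0.
Qed.

Lemma admissible_deriv_iter xi (eta : R) k : 0 < eta ->
  (forall e, 0 < e -> deriv_iter (dual_far e) (omega_pow xi) dual_image = set0) ->
  deriv_iter (fun u v => dual_far (5 * eta) (rest u : functionals Z) (rest v))
    (omul (omega_pow xi) (onat k)) (admissible 1) `<=` admissible (1 - k%:R * eta).
Proof.
move=> eta0 A0; elim: k => [|k IH]; first by rewrite mul0r subr0.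
rewrite [omul _ _]/= deriv_iter_add.
have -> : 1 - k.+1%:R * eta = (1 - k%:R * eta) - eta by rewrite -natr1; ring.
have r1 : 1 - k%:R * eta <= 1.
  by rewrite lerBlDr lerDl; apply: mulr_ge0 => //; exact: ltW.
by move=> p /(deriv_iter_mono IH); exact: admissible_deriv.
Qed.

(** The factor 10 is twice the 5 of the mass estimate, lost when derivations are lifted to the
    parameters. After [k] blocks the mass bound [1 - k * eta] is negative, which already the empty
    partial sum contradicts. *)
Lemma dual_ball_szlenk xi (eta : R) k : 0 < eta -> 1 < k%:R * eta ->
  (forall e, 0 < e -> deriv_iter (dual_far e) (omega_pow xi) dual_image = set0) ->
  szlenk_iter (10 * eta) (omul (omega_pow xi) (onat k)) (dual_ball Z) = set0.
Proof.
move=> eta0 ke A0; rewrite szlenk_iterE -subset0 => f.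
have sub : dual_ball Z `<=` (fun p => rest p : functionals Z) @` admissible 1.
  by move=> h /dual_ball_rest[p admp <-]; exists p.
have -> : 10 * eta = 5 * eta + 5 * eta by ring.
move=> /(deriv_iter_mono sub) Hf.
have [p Hp _] := deriv_iter_lift functionals_hausdorff rest_nbhs
  (admissible_compact (Q := setT) (r := 1) I)
  (fun x y t => @dual_far_split R s Z (5 * eta) x y t) Hf.
have [/(_ 0%N) H _ _ _] := admissible_deriv_iter eta0 A0 Hp.
by move: H; rewrite big_ord0 subr_ge0 leNgt ke.
Qed.

End Estimate.

(** * Conclusion *)

Section Factorization.
Context {R : realType} {s : scalars R}.
Local Notation K := (scalar_field s).
Variables (X Y : completeNormedModType K) (A : {linear X -> Y}).
Variable A_bounded : bounded_map A.
Local Notation Z := (interp_space A_bounded).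

Lemma image_kfun_vanish x : A x \in kfun_vanish A.
Proof.
apply/asboolP => e e0; have [m Hm] := exp2_unbounded (rnorm x / e).
exists m => n mn; apply: le_trans (kfun_image A n x) _.
rewrite mulrC ler_pdivrMr ?exprn_gt0 // mulrC -ler_pdivrMr //.
by apply: le_trans Hm _; rewrite ler_eXn2l ?ltr1n.
Qed.

Definition interp_embed (x : X) : Z := Interp A_bounded (image_kfun_vanish x).

Lemma interp_embed_linear : linear interp_embed.
Proof. by move=> a u v; apply: val_inj; rewrite /= linearP. Qed.

Lemma interp_embed_bounded : bounded_map interp_embed.
Proof.
exists 1 => x; rewrite mul1r rnorm_interp; apply: ksup_le => [|n _].
  exact: interp_valP.
apply: le_trans (kfun_image A n x) _; rewrite mulrC ler_piMr ?rnorm_ge0 //.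
by rewrite invf_le1 ?exprn_gt0 // -natrX ler1n expn_gt0.
Qed.

Lemma interp_factorization : exists (S : {linear X -> Z}) (T : {linear Z -> Y}),
  bounded_map S /\ bounded_map T /\ forall x : X, A x = T (S x).
Proof.
pose mS := GRing.isLinear.Build K X Z *:%R interp_embed interp_embed_linear.
pose S : {linear X -> Z} := HB.pack interp_embed mS.
exists S, (val : {linear Z -> Y}); split; first exact: interp_embed_bounded.
by split=> //; exact: (interp_val_bounded A_bounded).
Qed.

End Factorization.

Lemma operator_Sz_le (R : realType) (s : scalars R)
    (X Y : normedModType (scalar_field s)) (A : X -> Y) a (e : R) : 0 < e ->
  xole (operator_Sz A) a ->
  deriv_iter (dual_far e) a
    [set ((g : Y -> (scalar_field s)^o) \o A : functionals X) | g in dual_ball Y] = set0.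
Proof.
move=> e0; rewrite /operator_Sz /Sz /xosup; case: asboolP => //= H Ha.
rewrite -szlenk_iterE -subset0; have := H (PosNum e0); have := Ha (PosNum e0).
case E: (Sz_eps _ _) => [b|] //= ba _; have <- := oleast_some E.
by rewrite !szlenk_iterE; exact: deriv_iter_anti.
Qed.

Lemma xord_ereal_le (R : realType) a n : ole a (onat n) ->
  (0 <= xord_ereal R (Some a) <= n%:R%:E)%E.
Proof.
move=> an; apply/andP; split; first by apply: ereal_sup_ubound; exists 0%N.
apply: ge_ereal_sup => _ [m /= ma <-]; rewrite lee_fin ler_nat.
by apply: ole_onat; exact: ole_trans ma an.
Qed.

(** For [e < 1] the bound [10 / e + 1] is below [11 / e], so the quotient of logarithms is at most
    [1 + ln 11 / |ln e|]; the gap between 1 and [p] absorbs the second term. The finite bounds also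
    give the condition on [Sz B] without which the power is infinite by definition. *)
Lemma szlenk_power_le (R : realType) (s : scalars R)
    (X : normedModType (scalar_field s)) (xi : ord) (B : set (functionals X)) (p : R) :
  1 < p ->
  (forall e : R, 0 < e -> exists k, k%:R <= 10 / e + 1 /\
     szlenk_iter e (omul (omega_pow xi) (onat k)) B = set0) ->
  (szlenk_power xi B <= p%:E)%E.
Proof.
move=> p1 HB.
have HSz : xole (Sz B) (omega_pow (Osucc xi)).
  rewrite /Sz /xosup; case: asboolP => [H|H].
    move=> e /=; have [k [_ Hk]] := HB e%:num [gt0 of e%:num].
    have [b Eb [_ bk]] := oleast_le (P := fun a => szlenk_iter e%:num a B = set0) Hk.
    rewrite [Sz_eps _ _]Eb /=; apply: ole_trans bk _.
    exact: (@ole_lim_r _ nat _ (fun n => omul (omega_pow xi) (onat n)) k (ole_refl _)).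
  exfalso; apply: H => e; have [k [_ Hk]] := HB e%:num [gt0 of e%:num].
  have [b Eb _] := oleast_le (P := fun a => szlenk_iter e%:num a B = set0) Hk.
  by rewrite [Sz_eps _ _]Eb.
rewrite /szlenk_power asboolT //.
(* Chosen so that [ln 11 <= (p - 1) * |ln e|] for [e] below [e0]; the minimum with 1 keeps [ln e]
   negative. *)
pose e0 := Num.min 1 (expR (- (ln 11 / (p - 1)))).
have e00 : 0 < e0 by rewrite lt_min ltr01 expR_gt0.
have nbhs0 : nbhs 0^'+ [set` `]0, e0[].
  apply: filterS (filterI (nbhs_right_gt 0) (nbhs_right_lt e00)) => e [e_gt0 ee0].
  by rewrite /= in_itv /= e_gt0 ee0.
apply: (le_trans (ereal_inf_lbound (ex_intro2 _ _ _ nbhs0 erefl))).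
apply: ge_ereal_sup => _ [e eI <-].
move: eI; rewrite /= in_itv /= => /andP[e_gt0 ee0].
have e1 : e < 1 by apply: lt_le_trans ee0 _; rewrite ge_min lexx.
have lne0 : 0 < - ln e by rewrite oppr_gt0 ln_lt0 // e_gt0.
have [k [ke Hk]] := HB e e_gt0.
have [b Eb [_ bk]] :=
  oleast_le (P := fun b => szlenk_iter e (omul (omega_pow xi) b) B = set0) Hk.
rewrite [Sz_xi _ _ _]Eb ltr0_norm -?oppr_gt0 // inver gt_eqF // lee_pdivrMr //.
have /andP[x0 xk] := xord_ereal_le R bk.
(* If [B] is empty, [k] may be 0; the extended logarithm of 0 is then [-oo] and the bound is
   trivial. *)
have [k0|k0] := eqVneq k 0%N.
  rewrite le0_lneNy ?leNye //; by apply: le_trans xk _; rewrite k0.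
have k0' : 0 < k%:R :> R by rewrite ltr0n lt0n.
apply: (@le_trans _ _ (lne k%:R%:E)).
  by rewrite lee_lne // in_itv /= ?x0 ?leey // lee_fin ltW.
rewrite lne_EFin // -EFinM lee_fin.
have k11 : k%:R <= 11 / e.
  apply: le_trans ke _; rewrite -lerBrDl -mulrBl.
  have -> : 11 - 10 = 1 :> R by ring.
  by rewrite mul1r invf_ge1 // ltW.
apply: (@le_trans _ _ (ln (11 / e))).
  by rewrite ler_ln // posrE divr_gt0.
rewrite ln_div ?posrE //.
have : ln e <= - (ln 11 / (p - 1)).
  rewrite -[leRHS]expRK ler_ln ?posrE ?expR_gt0 //.
  by apply: le_trans (ltW ee0) _; rewrite ge_min lexx orbT.
have p10 : 0 < p - 1 by rewrite subr_gt0.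
rewrite lerNr ler_pdivrMr //; lra.
Qed.

Theorem corollary6p5 (R : realType) (s : scalars R) (xi : ord)
    (X Y : completeNormedModType (scalar_field s)) (A : {linear X -> Y})
    (A_bounded : bounded_map A)
    (A_szlenk : xole (operator_Sz A) (omega_pow xi))
    (p : R) (p_gt1 : (1 < p)%R) :
  exists Z : completeNormedModType (scalar_field s),
    (space_szlenk_power xi Z <= p%:E)%E /\
    exists (S : {linear X -> Z}) (T : {linear Z -> Y}),
      bounded_map S /\ bounded_map T /\ forall x : X, A x = T (S x).
Proof.
exists (interp_space A_bounded); split; last exact: interp_factorization.
(* With [eta = e / 10] this is the integer [k] with [k - 1 <= 10 / e < k]: strictly large enough for
   [k * eta > 1], and at most [10 / e + 1]. *)
apply: szlenk_power_le => // e e0; exists (Num.truncn (10 / e)).+1.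
have e10 : 0 <= 10 / e by rewrite divr_ge0 // ltW.
split; first by rewrite -natr1 lerD2r; have /andP[] := truncn_itv e10.
have eE : 10 * (e / 10) = e by rewrite mulrC divfK.
rewrite -[X in szlenk_iter X]eE; apply: dual_ball_szlenk; first by rewrite divr_gt0.
  rewrite mulrA ltr_pdivlMr // mul1r -ltr_pdivrMr //.
  by have /andP[] := truncn_itv e10.
by move=> d d0; exact: operator_Sz_le.
Qed.
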